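(* Let $X\subset\mathcal{H}(\mathbb{D})$ be a Banach space, and let $(\Omega,\mu)$ be a finite measure space with $\mu$ a positive measure. Let $K:\mathbb{D}\times\Omega\to\mathbb{C}$ be a kernel such that (i) $z\mapsto K(z,w)$ is analytic for all $w\in\Omega$; (ii) $w\mapsto K(z,w)$ is measurable for all $z\in\mathbb{D}$; (iii) $\sup_{z\in E,\,w\in\Omega}|K(z,w)|<\infty$ for each compact subset $E\subset\mathbb{D}$. Let $g\in\mathcal{H}(\mathbb{D})$, $1<p\le\infty$, and $$P(h)(z)=\int_\Omega h(w)K(z,w)\,d\mu(w),\qquad z\in\mathbb{D},$$ and suppose that $P:L^p(\Omega)\to X$ is bounded and onto. Then $T_g:X\to H^\infty$ is bounded if and only if $$\sup_{z\in\mathbb{D}}\int_\Omega\left|\int_0^z g'(\zeta)K(\zeta,w)\,d\zeta\right|^{p'}d\mu(w)<\infty.$$ Moreover, there exists $M=M(P)>0$ such that $$M^{-p'}\|T_g\|^{p'}_{X\to H^\infty}\le\sup_{z\in\mathbb{D}}\int_\Omega\left|\int_0^z g'(\zeta)K(\zeta,w)\,d\zeta\right|^{p'}d\mu(w)\le\|P\|^{p'}\|T_g\|^{p'}_{X\to H^\infty}.$$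
   Context: $\mathbb{D}$ is the open unit disc, $\mathcal{H}(\mathbb{D})$ the space of analytic functions in $\mathbb{D}$, $H^\infty$ the bounded analytic functions with sup norm. $T_g(f)(z)=\int_0^z f(\zeta)g'(\zeta)\,d\zeta$. $p'$ is the conjugate exponent, $\frac1p+\frac1{p'}=1$ ($p'=1$ if $p=\infty$). $L^p(\Omega)=L^p(\Omega,\mu)$. $\|P\|$ is the operator norm of $P:L^p(\Omega)\to X$, and the constant $M$ depends only on $P$. *)

(* Defs.v *)
From HB Require Import structures.
From mathcomp Require Import all_boot all_order all_algebra.
From mathcomp Require Import complex.
From mathcomp Require Import all_classical all_reals all_analysis.

Set Implicit Arguments.
Unset Strict Implicit.
Unset Printing Implicit Defensive.

Import Order.TTheory GRing.Theory Num.Theory.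
Import numFieldNormedType.Exports.

Local Open Scope classical_set_scope.
Local Open Scope ring_scope.
Local Open Scope complex_scope.

(* [R[i]^o] is [R[i]] with its topology and its structure of normed module over
   [R[i]]. *)
Notation Cplx R := ((complex (Real.sort R))^o).

(* Norms over [R[i]] take their values in [R[i]], as nonnegative real elements;
   [rnorm] is the same norm with values in [R]. *)
Definition rnorm (R : realType) (V : normedModType R[i]) (x : V) : R :=
  complex.Re `|x|.

Section analytic_functions.
Variable R : realType.
Implicit Types f g : Cplx R -> Cplx R.

Definition unit_disc : set (Cplx R) := [set z | `|z| < 1].

Definition analytic_at f (z0 : Cplx R) : Prop :=
  exists a : nat -> Cplx R,
    \forall z \near z0, series (fun n => a n * (z - z0) ^+ n) @ \oo --> f z.

(* The space H(D). Elements are total functions of which only the values on the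
   disc matter; the values elsewhere are unconstrained. *)
Definition analytic_on_disc f : Prop :=
  forall z, unit_disc z -> analytic_at f z.

Definition in_Hinfty f : Prop :=
  analytic_on_disc f /\
  exists B : R, forall z, unit_disc z -> rnorm (f z) <= B.

Definition Hinfty_norm f : \bar R :=
  ereal_sup [set (rnorm (f z))%:E | z in unit_disc].

Definition cmeasurable d (T : measurableType d) (f : T -> Cplx R) : Prop :=
  measurable_fun setT (fun x => complex.Re (f x)) /\
  measurable_fun setT (fun x => complex.Im (f x)).

Definition cintegral d (T : measurableType d) (mu : {measure set T -> \bar R})
    (A : set T) (f : T -> Cplx R) : Cplx R :=
  (\int[mu]_(x in A) complex.Re (f x)) +i* (\int[mu]_(x in A) complex.Im (f x)).

(* \int_0^z f(zeta) dzeta along the segment zeta = t z, 0 <= t <= 1. *)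
Definition segment_integral f (z : Cplx R) : Cplx R :=
  z * cintegral (@lebesgue_measure R) `[0, 1] (fun t => f (t%:C * z)).

Definition T_op g f (z : Cplx R) : Cplx R :=
  segment_integral (fun zeta => f zeta * derive1 g zeta) z.

(* A vector space X of analytic functions on the disc, given by the function
   [ev x] that each [x : X] represents. The norm of X is that of the normed
   module X and is not related to [ev]. *)
Definition analytic_function_space (X : normedModType R[i])
    (ev : X -> Cplx R -> Cplx R) : Prop :=
  [/\ forall x, analytic_on_disc (ev x),
      forall (c : R[i]) x y z, unit_disc z ->
        ev (c *: x + y) z = c * ev x z + ev y z &
      forall x y, (forall z, unit_disc z -> ev x z = ev y z) -> x = y].

Definition T_bounded g (X : normedModType R[i])
    (ev : X -> Cplx R -> Cplx R) : Prop :=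
  (forall x, in_Hinfty (T_op g (ev x))) /\
  exists B : R, forall x, (Hinfty_norm (T_op g (ev x)) <= (B * rnorm x)%:E)%E.

(* Equal to +oo when [T_op g] is not bounded from X to H^infty. *)
Definition T_norm g (X : normedModType R[i])
    (ev : X -> Cplx R -> Cplx R) : \bar R :=
  ereal_sup [set Hinfty_norm (T_op g (ev x)) | x in [set x : X | `|x| <= 1]].

Section kernel_operator.
Context d (Omega : measurableType d) (mu : {measure set Omega -> \bar R}).
Implicit Types (p : \bar R) (h : Omega -> Cplx R).
Implicit Types K : Cplx R -> Omega -> Cplx R.

Definition cLnorm p h : \bar R := Lnorm mu p (fun w => (rnorm (h w))%:E).

(* L^p(Omega, mu), by representatives: functions equal almost everywhere are
   not identified. *)
Definition in_cLp p h : Prop := cmeasurable h /\ (cLnorm p h < +oo)%E.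

(* Only the values of [P] on L^p are meaningful. *)
Definition represents_kernel p K (X : normedModType R[i])
    (ev : X -> Cplx R -> Cplx R) (P : (Omega -> Cplx R) -> X) : Prop :=
  forall h, in_cLp p h -> forall z, unit_disc z ->
    ev (P h) z = cintegral mu setT (fun w => h w * K z w).

Definition bounded_on_Lp p (X : normedModType R[i])
    (P : (Omega -> Cplx R) -> X) : Prop :=
  exists B : R, forall h, in_cLp p h ->
    ((rnorm (P h))%:E <= B%:E * cLnorm p h)%E.

Definition onto_from_Lp p (X : normedModType R[i])
    (P : (Omega -> Cplx R) -> X) : Prop :=
  forall x, exists2 h, in_cLp p h & P h = x.

Definition P_norm p (X : normedModType R[i])
    (P : (Omega -> Cplx R) -> X) : \bar R :=
  ereal_sup [set (rnorm (P h))%:E |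
             h in [set h | in_cLp p h /\ (cLnorm p h <= 1)%E]].

(* sup_{|z| < 1} \int_Omega |\int_0^z g'(zeta) K(zeta, w) dzeta|^q dmu(w) *)
Definition kernel_sup g K (q : R) : \bar R :=
  ereal_sup [set (\int[mu]_w
      (rnorm (segment_integral (fun zeta => derive1 g zeta * K zeta w) z)
        `^ q)%:E)%E
    | z in unit_disc].

End kernel_operator.
End analytic_functions.

(* Main.v *)
Require Import Defs.
From HB Require Import structures.
From mathcomp Require Import all_boot all_order all_algebra.
From mathcomp Require Import complex.
From mathcomp Require Import all_classical all_reals all_analysis measurable_realfun ess_sup_inf.
From mathcomp Require Import ring lra.

(* For [h] in L^p, Fubini gives T_g(P h)(z) = \int_Omega h k_z dmu, where k_z(w) is
   the integral of g' K(., w) along the segment [0, z]. As P is bounded and onto,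
   the open mapping theorem represents every x in X as P h with ||h||_p <= M ||x||.
   Hence the norm of x |-> T_g x(z) is comparable to the norm of k_z as a
   functional on L^p, that is, to ||k_z||_p': the lower estimate is Hoelder's
   inequality, the upper one tests with the extremal function of that inequality.
   That T_g x is analytic does not need Cauchy's theorem: differentiating under the
   integral sign shows that the primitive along segments of an analytic function f
   has derivative f, so that it differs from the termwise primitives of the power
   series of f by local constants. *)

Import Order.TTheory GRing.Theory Num.Theory.
Import numFieldNormedType.Exports.
Set Implicit Arguments.
Unset Strict Implicit.
Local Open Scope classical_set_scope.
Local Open Scope ring_scope.

(** * Real-valued norms of complex normed modules *)

(** Two facts have to be earned before the argument starts. [P] is only a function on
    representatives that satisfies the kernel formula; it is linear because an element of X is
    determined by its values on the disc. And k_z is a segment integral whose measurability in w has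
    to be derived, from the continuity of K(., w) along the segment and the measurability of K(z,
    .). The open mapping theorem is proved on representatives, by Baire's theorem in X and the
    summation of geometrically decreasing series in L^p, so that no quotient space is formed.
    Analyticity is mostly used through the estimate |f(v) - f(u) - (v - u) f'(u)| <= M |v - u|^2,
    uniform near a point: continuity, the fundamental theorem along segments and differentiation
    under the integral sign then become plain inequalities. Each k_z is bounded and [mu] is finite,
    so the extremal function can be normalised before anything is known about T_g, and the estimates
    hold with infinite values too. The final constant is twice that of the open mapping theorem; the
    2 comes from bounding real and imaginary parts separately. *)

Section rnorm_theory.
Variable R : realType.
Local Open Scope complex_scope.

Lemma norm_rnorm (V : normedModType R[i]) (x : V) : `|x| = (rnorm x)%:C.
Proof. by rewrite /rnorm RRe_real// normr_real. Qed.

Lemma rnorm_ge0 (V : normedModType R[i]) (x : V) : 0 <= rnorm x.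
Proof. by rewrite -lecR -norm_rnorm; exact: normr_ge0. Qed.

Lemma rnorm0 (V : normedModType R[i]) : rnorm (0 : V) = 0.
Proof. by rewrite /rnorm normr0. Qed.

Lemma rnorm_eq0 (V : normedModType R[i]) (x : V) : rnorm x = 0 -> x = 0.
Proof. by move=> x0; apply/eqP; rewrite -normr_eq0 norm_rnorm x0. Qed.

Lemma rnormN (V : normedModType R[i]) (x : V) : rnorm (- x) = rnorm x.
Proof. by rewrite /rnorm normrN. Qed.

Lemma rdistC (V : normedModType R[i]) (x y : V) : rnorm (x - y) = rnorm (y - x).
Proof. by rewrite -rnormN opprB. Qed.

Lemma ler_rnormD (V : normedModType R[i]) (x y : V) :
  rnorm (x + y) <= rnorm x + rnorm y.
Proof. by rewrite -lecR rmorphD/= -!norm_rnorm ler_normD. Qed.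

Lemma ler_rnormB (V : normedModType R[i]) (x y : V) :
  rnorm (x - y) <= rnorm x + rnorm y.
Proof. by rewrite -(rnormN y) ler_rnormD. Qed.

Lemma ler_rdistD (V : normedModType R[i]) (z x y : V) :
  rnorm (x - y) <= rnorm (x - z) + rnorm (z - y).
Proof. by rewrite (le_trans _ (ler_rnormD _ _))// subrKA. Qed.

Lemma ler_rnorm_dist (V : normedModType R[i]) (x y : V) :
  `|rnorm x - rnorm y| <= rnorm (x - y).
Proof.
have H u v : rnorm (u : V) - rnorm v <= rnorm (u - v).
  by rewrite lerBlDr (le_trans _ (ler_rnormD _ _))// subrK.
by rewrite ler_norml H andbT lerNl opprB rdistC H.
Qed.

Lemma ler_rnorm_sum (V : normedModType R[i]) I (s : seq I) (P : pred I)
    (F : I -> V) :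
  rnorm (\sum_(i <- s | P i) F i) <= \sum_(i <- s | P i) rnorm (F i).
Proof.
elim/big_ind2 : _ => [|x a y b xa yb|//]; first by rewrite rnorm0.
by rewrite (le_trans (ler_rnormD _ _))// lerD.
Qed.

Lemma rnormZ (V : normedModType R[i]) (c : R[i]) (x : V) :
  rnorm (c *: x) = rnorm (c : Cplx R) * rnorm x.
Proof.
apply: complexI.
by rewrite rmorphM/= -!norm_rnorm normrZ.
Qed.

Implicit Types z w : Cplx R.

Lemma rnormM z w : rnorm (z * w) = rnorm z * rnorm w.
Proof. exact: (@rnormZ (Cplx R)). Qed.

Lemma rnorm1 : rnorm (1 : Cplx R) = 1.
Proof. by rewrite /rnorm normr1. Qed.

Lemma rnormX z n : rnorm (z ^+ n) = rnorm z ^+ n.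
Proof.
elim: n => [|n ih]; first by rewrite !expr0 rnorm1.
by rewrite !exprS rnormM ih.
Qed.

Lemma rnormV z : rnorm (z^-1) = (rnorm z)^-1.
Proof.
have [->|z0] := eqVneq z 0; first by rewrite invr0 rnorm0 invr0.
have r0 : rnorm z != 0 by apply: contra z0 => /eqP/rnorm_eq0/eqP.
by apply: (mulfI r0); rewrite -rnormM divff// rnorm1 divff.
Qed.

Lemma rnorm_real (r : R) : rnorm (r%:C : Cplx R) = `|r|.
Proof. by rewrite /rnorm normc_def/= expr0n/= addr0 sqrtr_sqr. Qed.

Lemma rnormE z : rnorm z = Num.sqrt (complex.Re z ^+ 2 + complex.Im z ^+ 2).
Proof. by rewrite /rnorm normc_def. Qed.

Lemma Re_le_rnorm z : `|complex.Re z| <= rnorm z.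
Proof. by rewrite rnormE -sqrtr_sqr ler_wsqrtr// lerDl sqr_ge0. Qed.

Lemma Im_le_rnorm z : `|complex.Im z| <= rnorm z.
Proof. by rewrite rnormE -sqrtr_sqr ler_wsqrtr// lerDr sqr_ge0. Qed.

Lemma rnorm_le_ReIm z : rnorm z <= `|complex.Re z| + `|complex.Im z|.
Proof.
rewrite rnormE -[leRHS]ger0_norm ?addr_ge0// -sqrtr_sqr ler_wsqrtr//.
rewrite sqrrD !real_normK ?num_real// addrAC lerDl mulrn_wge0 ?mulr_ge0//.
Qed.

Lemma rnorm_natr n : rnorm (n%:R : Cplx R) = n%:R.
Proof.
have -> : (n%:R : Cplx R) = (n%:R : R)%:C by rewrite rmorph_nat.
by rewrite rnorm_real normr_nat.
Qed.

Lemma unit_discE z : unit_disc z <-> rnorm z < 1.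
Proof. by rewrite /unit_disc/= norm_rnorm (_ : 1 = 1%:C)// ltcR. Qed.

End rnorm_theory.

(** * Limits and neighbourhoods through the real-valued norm *)

Section rnorm_topology.
Variable R : realType.
Local Open Scope complex_scope.

Lemma posC (e : R[i]) : 0 < e -> exists2 r : R, 0 < r & e = r%:C.
Proof.
case: e => a b; rewrite ltcE/= => /andP[/eqP b0 a0].
by exists a => //; rewrite b0.
Qed.

Lemma near_rnormP (V : normedModType R[i]) (x : V) (P : set V) :
  (\forall y \near x, P y) <->
  exists2 r : R, 0 < r & forall y, rnorm (y - x) < r -> P y.
Proof.
split.
  move=> /nbhs_ballP[e /posC[r r0 ->] H]; exists r => // y xy.
  by apply: H; rewrite -ball_normE/= norm_rnorm rdistC ltcR.
move=> [r r0 H]; apply/nbhs_ballP; exists r%:C => /=; first by rewrite ltcR.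
by move=> y; rewrite -ball_normE/= norm_rnorm rdistC ltcR; apply: H.
Qed.

Lemma cvg_rnormP (V : normedModType R[i]) T (F : set_system T) {FF : Filter F}
    (f : T -> V) (l : V) :
  f @ F --> l <-> forall e : R, 0 < e -> \forall t \near F, rnorm (f t - l) < e.
Proof.
split.
  move=> /cvgrPdist_lt H e e0.
  have /H : 0 < e%:C by rewrite ltcR.
  by apply: filterS => t; rewrite norm_rnorm rdistC ltcR.
move=> H; apply/cvgrPdist_lt => e /posC[r r0 ->].
by apply: filterS (H r r0) => t; rewrite norm_rnorm rdistC ltcR.
Qed.

Lemma rnorm_lim_le (V : normedModType R[i]) T (F : set_system T)
    {FF : ProperFilter F} (f : T -> V) (l : V) (M : R) :
  f @ F --> l -> (\forall t \near F, rnorm (f t) <= M) -> rnorm l <= M.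
Proof.
move=> /cvg_rnormP fl fM; apply/ler_addgt0Pr => e e0.
have [t [tl tM]] : exists t, rnorm (f t - l) < e /\ rnorm (f t) <= M.
  by apply: (@filter_ex _ F); near=> t; split; near: t => //; exact: fl.
have -> : l = f t - (f t - l) by rewrite opprB addrC subrK.
by rewrite (le_trans (ler_rnormB _ _))// lerD// ltW.
Unshelve. all: by end_near. Qed.

Lemma cauchy_rnorm_cvg (V : completeNormedModType R[i]) (u : nat -> V) :
  (forall e : R, 0 < e -> exists N, forall n, (N <= n)%N ->
      rnorm (u n - u N) < e) ->
  exists l : V, u @ \oo --> l.
Proof.
move=> H; suff /cauchy_cvg : cauchy (u @ \oo).
  by move=> h; exists (lim (u @ \oo)).
apply/cauchy_ballP => e /posC[r r0 ->].
have [N HN] := H (r / 2) ltac:(lra).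
have HN' : \forall n \near \oo, rnorm (u n - u N) < r / 2.
  by exists N => // n /=; exact: HN.
have HP : \forall n & m \near u @ \oo, rnorm (n - m) < r.
  exists ([set y | rnorm (y - u N) < r / 2], [set y | rnorm (y - u N) < r / 2]) => //=.
  move=> [y z] /= [yr zr]; rewrite (le_lt_trans (ler_rdistD (u N) _ _))//.
  rewrite [X in _ + X]rdistC.
  lra.
apply: filterS HP => -[y z] /=.
by rewrite -ball_normE/= norm_rnorm ltcR.
Qed.

End rnorm_topology.

(** * Power series *)

Section power_series.
Variable R : realType.
Local Open Scope complex_scope.
Implicit Types (f : Cplx R -> Cplx R) (u v w z : Cplx R) (a b : nat -> Cplx R).

Lemma cvg_complex T (F : set_system T) {FF : Filter F} (s t : T -> R) (x y : R) :
  s @ F --> x -> t @ F --> y ->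
  (fun n => s n +i* t n : Cplx R) @ F --> (x +i* y : Cplx R).
Proof.
move=> /cvgrPdist_lt sx /cvgrPdist_lt ty; apply/cvg_rnormP => e e0.
have e2 : 0 < e / 2 by lra.
apply: filterS2 (sx _ e2) (ty _ e2) => n h1 h2.
rewrite (le_lt_trans (rnorm_le_ReIm _))//= distrC [X in _ + X]distrC.
lra.
Qed.

Lemma cvg_cmull T (F : set_system T) {FF : Filter F} (s : T -> Cplx R) c x :
  s @ F --> x -> (fun n => c * s n) @ F --> c * x.
Proof. exact: (@cvgZl_tmp _ (Cplx R)). Qed.

Lemma half_series_le (C : R) n : 0 <= C -> \sum_(0 <= k < n) C / 2 ^+ k <= 2 * C.
Proof.
move=> C0; suff -> : \sum_(0 <= k < n) C / 2 ^+ k = 2 * C - C / 2 ^+ n * 2.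
  by rewrite lerBlDr lerDl mulr_ge0// divr_ge0// exprn_ge0.
elim: n => [|n ih]; first by rewrite big_geq// expr0 divr1 mulrC subrr.
rewrite big_nat_recr//= ih exprS invfM.
by field; rewrite expf_neq0.
Qed.

Lemma sum_half_le (C : R) a n : (forall n, rnorm (a n) <= C / 2 ^+ n) ->
  rnorm (series a n) <= 2 * C.
Proof.
move=> aC; have C0 : 0 <= C.
  by have := le_trans (rnorm_ge0 _) (aC 0); rewrite expr0 divr1.
rewrite /series/= (le_trans (ler_rnorm_sum _ _ _))//.
by rewrite (le_trans _ (half_series_le n C0))// ler_sum.
Qed.

(** Real and imaginary parts are real series dominated by the moduli, hence absolutely convergent by
    monotone convergence. *)
Lemma cvg_series_rnorm_bounded (M : R) a :
  (forall n, \sum_(0 <= k < n) rnorm (a k) <= M) ->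
  exists l : Cplx R, series a @ \oo --> l.
Proof.
move=> aM.
have cvg_part (g : Cplx R -> R) : (forall z, `|g z| <= rnorm z) ->
    cvgn (series (g \o a)).
  move=> gr; apply: normed_cvg; apply: nondecreasing_is_cvgn.
    by apply: nondecreasing_series => n _ _; exact: normr_ge0.
  exists M => _ [n _ <-]; rewrite (le_trans _ (aM n))//.
  by rewrite /series/= ler_sum.
have cRe := cvg_part (fun z => complex.Re z) (@Re_le_rnorm R).
have cIm := cvg_part (fun z => complex.Im z) (@Im_le_rnorm R).
exists (lim (series ((fun z => complex.Re z) \o a) @ \oo) +i*
        lim (series ((fun z => complex.Im z) \o a) @ \oo)).
rewrite [X in X @ _](_ : _ = fun n => series ((fun z => complex.Re z) \o a) n +i*
    series ((fun z => complex.Im z) \o a) n); first exact: cvg_complex.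
apply/funext => n; rewrite /series/=.
elim: n => [|n ih]; first by rewrite !big_geq.
by rewrite !big_nat_recr//= ih; case: (a n).
Qed.

Lemma cvg_series_half (C : R) a : (forall n, rnorm (a n) <= C / 2 ^+ n) ->
  exists l : Cplx R, series a @ \oo --> l.
Proof.
move=> aC; apply: (@cvg_series_rnorm_bounded (2 * C)) => n.
have C0 : 0 <= C by have := le_trans (rnorm_ge0 _) (aC 0); rewrite expr0 divr1.
by rewrite (le_trans _ (half_series_le n C0))// ler_sum.
Qed.

(** Besides the expansion on a ball, a Cauchy-type bound on the coefficients is recorded: it reduces
    the later estimates to geometric series. *)
Definition power_series_at f z0 a (r C : R) :=
  [/\ 0 < r, forall n, rnorm (a n) * r ^+ n <= C &
    forall z, rnorm (z - z0) < r ->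
      series (fun n => a n * (z - z0) ^+ n) @ \oo --> f z].

(** Convergence at the single point z0 + r0 / 2 makes the terms there tend to 0, hence bounded; the
    finitely many terms that exceed 1 are absorbed in [C]. *)
Lemma analytic_power_series f z0 : analytic_at f z0 ->
  exists a r C, power_series_at f z0 a r C.
Proof.
move=> [a /near_rnormP[r0 r00 H]].
have s0 : 0 < r0 / 2 by lra.
have szE : z0 + (r0 / 2)%:C - z0 = (r0 / 2)%:C by rewrite addrC addKr.
have : series (fun n => a n * (r0 / 2)%:C ^+ n) @ \oo --> f (z0 + (r0 / 2)%:C).
  rewrite -{1}szE; apply: H; rewrite szE rnorm_real ger0_norm; lra.
move=> /(cvgP _)/cvg_series_cvg_0/cvg_rnormP/(_ 1 ltr01) [N _ HN].
pose C := 1 + \sum_(0 <= k < N) rnorm (a k * (r0 / 2)%:C ^+ k).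
exists a, (r0 / 2), C; split => //.
- move=> n.
  have -> : rnorm (a n) * (r0 / 2) ^+ n = rnorm (a n * (r0 / 2)%:C ^+ n).
    by rewrite rnormM rnormX rnorm_real ger0_norm// ltW.
  rewrite /C; have [Nn|nN] := leqP N n.
    have := HN n Nn; rewrite subr0 => /ltW /le_trans; apply.
    by rewrite lerDl sumr_ge0// => *; exact: rnorm_ge0.
  rewrite (bigD1_seq n)/= ?iota_uniq ?mem_index_iota//.
  rewrite addrCA lerDl addr_ge0// sumr_ge0// => *; exact: rnorm_ge0.
- by move=> z zr; apply: H; lra.
Qed.

Lemma power_series_analytic f z0 a r C : power_series_at f z0 a r C ->
  analytic_at f z0.
Proof. by move=> [r0 _ H]; exists a; apply/near_rnormP; exists r. Qed.

Lemma power_series_bound_ge0 f z0 a r C : power_series_at f z0 a r C -> 0 <= C.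
Proof.
by move=> [r0 /(_ 0) H _]; rewrite (le_trans _ H)// mulr_ge0 ?rnorm_ge0.
Qed.

(** Shrinking the radius to r / 4 gains a factor 4^-n, which absorbs polynomial factors in n and
    still leaves a geometric series of ratio 1/2. *)
Lemma coef_bound a (r C : R) n : 0 < r -> rnorm (a n) * r ^+ n <= C ->
  rnorm (a n) <= C / (r / 4) ^+ n / 4 ^+ n.
Proof.
move=> r0; rewrite -ler_pdivlMr ?exprn_gt0// => /le_trans; apply.
by rewrite -mulrA -invfM -exprMn divfK.
Qed.

(** First-order Taylor remainder of the n-th power. The factor [rho ^+ 2] on the left avoids the
    exponent n - 2. In the induction the remainder is multiplied by [v] and n u^(n-1) (v - u)^2 is
    added. *)
Lemma binomial_quadratic u v (rho : R) n : 0 <= rho ->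
  rnorm u <= rho -> rnorm v <= rho ->
  rho ^+ 2 * rnorm (v ^+ n - u ^+ n - n%:R * u ^+ n.-1 * (v - u)) <=
    n%:R ^+ 2 * rho ^+ n * rnorm (v - u) ^+ 2.
Proof.
move=> rho0 ur vr; elim: n => [|n ih].
  by rewrite !expr0 subrr mul0r mul0r subr0 rnorm0 expr0n/= mulr0 !mul0r.
have -> : v ^+ n.+1 - u ^+ n.+1 - n.+1%:R * u ^+ n * (v - u) =
    v * (v ^+ n - u ^+ n - n%:R * u ^+ n.-1 * (v - u)) +
    n%:R * u ^+ n.-1 * (v - u) ^+ 2.
  case: n {ih} => [|n]; first by rewrite /= !expr0 !expr1 !mul0r; ring.
  by rewrite /= !exprS -!natr1; ring.
rewrite (le_trans (ler_wpM2l _ (ler_rnormD _ _)))// ?sqr_ge0// mulrDr.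
rewrite rnormM mulrCA.
have h1 := ler_pM (rnorm_ge0 _) (mulr_ge0 (sqr_ge0 _) (rnorm_ge0 _)) vr ih.
rewrite (le_trans (lerD h1 (lexx _)))//.
have h2 : rho ^+ 2 * rnorm (n%:R * u ^+ n.-1 * (v - u) ^+ 2) <=
    n%:R * rho ^+ n.+1 * rnorm (v - u) ^+ 2.
  case: n {ih h1} => [|n] /=.
    have -> : 0%:R * u ^+ 0 * (v - u) ^+ 2 = 0 :> Cplx R by ring.
    by rewrite rnorm0 mulr0 !mul0r.
  rewrite !rnormM !rnormX rnorm_natr mulrA ler_wpM2r ?sqr_ge0//.
  rewrite mulrCA ler_wpM2l// (exprD _ 2 n) ler_wpM2l ?sqr_ge0//.
  by rewrite lerXn2r// nnegrE rnorm_ge0.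
rewrite (le_trans (lerD (lexx _) h2))//.
have -> : rho * (n%:R ^+ 2 * rho ^+ n * rnorm (v - u) ^+ 2) +
   n%:R * rho ^+ n.+1 * rnorm (v - u) ^+ 2 =
   (n%:R ^+ 2 + n%:R) * rho ^+ n.+1 * rnorm (v - u) ^+ 2.
  by rewrite (exprS rho n); ring.
rewrite ler_wpM2r ?sqr_ge0// ler_wpM2r ?exprn_ge0//.
rewrite -natr1; have : 0 <= n%:R :> R by [].
by nra.
Qed.

Lemma sqrn_le_expn n : n%:R ^+ 2 <= 2 ^+ n.+1 :> R.
Proof.
(* The induction step needs (m + 1)^2 <= 2 m^2, which holds from m = 3 on. *)
case: n => [|[|[|n]]]; try by rewrite -!natrX ler_nat.
elim: n => [|n ih]; first by rewrite -!natrX ler_nat.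
rewrite [leRHS]exprS (le_trans _ (ler_wpM2l _ ih))// -natr1.
have : 3 <= n.+3%:R :> R by rewrite ler_nat.
move: (n.+3%:R : R) => m; nra.
Qed.

(** The estimate is uniform in both points, which later allows its use under an integral sign. [D]
    is the sum of the derived series; it is identified with [derive1 f] only afterwards. *)
Lemma power_series_deriv f z0 a r C : power_series_at f z0 a r C ->
  exists (D : Cplx R -> Cplx R) (M : R), [/\ 0 <= M,
    forall u, rnorm (u - z0) <= r / 4 ->
      series (fun n => n.+1%:R * a n.+1 * (u - z0) ^+ n) @ \oo --> D u &
    forall u v, rnorm (u - z0) <= r / 4 -> rnorm (v - z0) <= r / 4 ->
      rnorm (f v - f u - (v - u) * D u) <= M * rnorm (v - u) ^+ 2].
Proof.
move=> fa; have C0 := power_series_bound_ge0 fa; case: fa => r0 aC fa.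
have [rho rhoE] : exists rho, rho = r / 4 by exists (r / 4).
have rho0 : 0 < rho by lra.
have rhon0 n : rho ^+ n != 0 by rewrite expf_neq0// gt_eqF.
have two0 n : 2 ^+ n != 0 :> R by rewrite expf_neq0.
have four0 n : 4 ^+ n != 0 :> R by rewrite expf_neq0.
have aC4 n := coef_bound r0 (aC n); rewrite -rhoE in aC4.
rewrite -rhoE.
pose D u := lim (series (fun n => n.+1%:R * a n.+1 * (u - z0) ^+ n) @ \oo).
have DP u : rnorm (u - z0) <= rho ->
    series (fun n => n.+1%:R * a n.+1 * (u - z0) ^+ n) @ \oo --> D u.
  move=> ur.
  have [n|l] := @cvg_series_half (C / rho) (fun n => n.+1%:R * a n.+1 * (u - z0) ^+ n).
    rewrite !rnormM rnormX rnorm_natr.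
    have h1 : rnorm (u - z0) ^+ n <= rho ^+ n.
      by rewrite lerXn2r// nnegrE ?rnorm_ge0// ltW.
    have h2 : n.+1%:R <= 2 ^+ n.+1 :> R by rewrite -natrX ler_nat ltnW// ltn_expl.
    have h3 := ler_pM (ler0n R n.+1) (rnorm_ge0 _) h2 (aC4 n.+1).
    rewrite (le_trans (ler_pM _ _ h3 h1)) ?mulr_ge0 ?rnorm_ge0 ?exprn_ge0 ?rnorm_ge0//.
    have -> : 4 = 2 * 2 :> R by ring.
    have -> : 2 ^+ n.+1 * (C / rho ^+ n.+1 / (2 * 2) ^+ n.+1) * rho ^+ n = C / rho / 2 ^+ n.+1.
      rewrite !exprMn !exprS; move: (two0 n) (rhon0 n) (rhon0 1%N).
      by move: (2 ^+ n) (rho ^+ n) => ? ? ? ? ?; field; apply/and3P.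
    rewrite ler_wpM2l ?divr_ge0 ?(ltW rho0)//.
    by rewrite lef_pV2 ?posrE ?exprn_gt0// ler_eXn2l// ltr1n.
  by move=> /(cvgP _).
(* By [sqrn_le_expn] the n-th Taylor remainder is at most 2 C / rho^2 times |v - u|^2 / 2^n; summing
   the geometric series doubles the constant. *)
exists D, (2 * (2 * C / rho ^+ 2)); split => //.
  by rewrite mulr_ge0// divr_ge0 ?exprn_ge0 ?(ltW rho0)// mulr_ge0.
move=> u v ur vr; have fcvg w : rnorm (w - z0) <= rho ->
    series (fun n => a n * (w - z0) ^+ n) @ \oo --> f w.
  by move=> wr; apply: fa; rewrite (le_lt_trans wr)//; lra.
pose E n := a n * ((v - z0) ^+ n - (u - z0) ^+ n -
                   n%:R * (u - z0) ^+ n.-1 * (v - u)).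
have vuE : v - u = (v - z0) - (u - z0) by rewrite opprB subrKA.
have EC n : rnorm (E n) <= 2 * C / rho ^+ 2 * rnorm (v - u) ^+ 2 / 2 ^+ n.
  rewrite rnormM.
  have := binomial_quadratic n (ltW rho0) ur vr; rewrite -vuE.
  rewrite mulrC -ler_pdivlMr ?exprn_gt0// => h1.
  rewrite (le_trans (ler_pM (rnorm_ge0 _) (rnorm_ge0 _) (aC4 n) h1))//.
  have h2 := sqrn_le_expn n.
  have -> : C / rho ^+ n / 4 ^+ n *
    (n%:R ^+ 2 * rho ^+ n * rnorm (v - u) ^+ 2 / rho ^+ 2) =
    n%:R ^+ 2 * (C / rho ^+ 2 * rnorm (v - u) ^+ 2 / 4 ^+ n).
    move: (four0 n) (rhon0 n) (rhon0 1%N).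
    by move: (4 ^+ n) (rho ^+ n) => ? ? ? ? ?; field; apply/and3P.
  have -> : 2 * C / rho ^+ 2 * rnorm (v - u) ^+ 2 / 2 ^+ n =
    2 ^+ n.+1 * (C / rho ^+ 2 * rnorm (v - u) ^+ 2 / 4 ^+ n).
    have -> : 4 = 2 * 2 :> R by ring.
    rewrite !exprMn !exprS; move: (two0 n) (rhon0 n) (rhon0 1%N).
    by move: (2 ^+ n) (rho ^+ n) => ? ? ? ? ?; field; apply/andP.
  rewrite ler_wpM2r// divr_ge0 ?exprn_ge0// mulr_ge0 ?sqr_ge0//.
  by rewrite divr_ge0 ?sqr_ge0.
have cE : series E @ \oo --> f v - f u - (v - u) * D u.
  (* The derived series has its index shifted by one: N of its terms go with N.+1 terms of the two
     series of [f], as the term of index 0 of [E] vanishes. *)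
  rewrite -cvg_shiftS.
  rewrite [X in X @ _](_ : _ = fun N =>
      series (fun n => a n * (v - z0) ^+ n) N.+1 -
      series (fun n => a n * (u - z0) ^+ n) N.+1 -
      (v - u) * series (fun n => n.+1%:R * a n.+1 * (u - z0) ^+ n) N).
    apply: cvgB; last by apply: cvg_cmull; exact: DP.
    apply: cvgB.
      by have := fcvg v vr; rewrite -cvg_shiftS.
    by have := fcvg u ur; rewrite -cvg_shiftS.
  apply/funext => N; elim: N => [|N ih].
    by rewrite /series/= !big_nat1 big_geq//= /E/= !expr0; ring.
  rewrite /= in ih *; rewrite seriesSr ih [in RHS]seriesSr [series _ N.+2 in RHS]seriesSr.
  rewrite [series (fun n => n.+1%:R * a n.+1 * (u - z0) ^+ n) N.+1]seriesSr.
  by rewrite /E /=; ring.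
have h : forall N, rnorm (series E N) <= 2 * (2 * C / rho ^+ 2) * rnorm (v - u) ^+ 2.
  by move=> N; rewrite -mulrA; exact: sum_half_le.
by apply: (rnorm_lim_le cE); exact: nearW.
Qed.

End power_series.

(** * Derivatives, primitives and products of analytic functions *)

Section analytic.
Variable R : realType.
Local Open Scope complex_scope.
Implicit Types (f : Cplx R -> Cplx R) (u v w z : Cplx R) (a b : nat -> Cplx R).

Lemma rnorm_cvg_unique (V : normedModType R[i]) T (F : set_system T)
    {FF : ProperFilter F} (f : T -> V) (x y : V) :
  f @ F --> x -> f @ F --> y -> x = y.
Proof. by move=> fx fy; apply: cvg_unique fx fy; exact: norm_hausdorff. Qed.

Lemma derive1_quadratic f u d (r M : R) : 0 < r ->
  (forall v, rnorm (v - u) < r ->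
     rnorm (f v - f u - (v - u) * d) <= M * rnorm (v - u) ^+ 2) ->
  derive1 f u = d.
Proof.
move=> r0 H; rewrite /derive1; apply: cvg_lim => //.
apply/cvg_rnormP => e e0.
have M0 : 0 < `|M| + 1 by rewrite (le_lt_trans (normr_ge0 M))// ltrDl.
have : \forall h \near (0 : Cplx R), rnorm h < Num.min r (e / (`|M| + 1)).
  apply/near_rnormP; exists (Num.min r (e / (`|M| + 1))).
    by rewrite lt_min r0 divr_gt0.
  by move=> y; rewrite subr0.
move=> hM; change (\forall h \near (0 : Cplx R),
  h != 0 -> rnorm (h^-1 *: (f (h + u) - f u) - d) < e).
apply: filterS hM => h + h0; rewrite lt_min => /andP[hr he].
have hn0 : 0 < rnorm h.
  by rewrite lt_neqAle rnorm_ge0 andbT eq_sym; apply: contra h0 => /eqP/rnorm_eq0/eqP.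
have := H (h + u); rewrite addrK => /(_ hr) H1.
have -> : h^-1 *: (f (h + u) - f u) - d = h^-1 * (f (h + u) - f u - h * d) :> Cplx R.
  by rewrite [RHS]mulrBr mulrA mulVf// mul1r.
rewrite rnormM rnormV mulrC ltr_pdivrMr// (le_lt_trans H1)// expr2 mulrA.
rewrite ltr_pM2r// (le_lt_trans (ler_wpM2r (ltW hn0) (ler_norm M)))//.
rewrite ltr_pdivlMr// in he; rewrite (le_lt_trans _ he)// mulrC ler_pM2l// lerDl//.
Qed.

Lemma power_series_quadratic f z0 a r C : power_series_at f z0 a r C ->
  exists M : R, [/\ 0 <= M,
    forall u, rnorm (u - z0) < r / 4 ->
      series (fun n => n.+1%:R * a n.+1 * (u - z0) ^+ n) @ \oo --> derive1 f u &
    forall u v, rnorm (u - z0) < r / 4 -> rnorm (v - z0) < r / 4 ->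
      rnorm (f v - f u - (v - u) * derive1 f u) <= M * rnorm (v - u) ^+ 2].
Proof.
move=> fa; have [D [M [M0 DP H]]] := power_series_deriv fa.
have DE u : rnorm (u - z0) < r / 4 -> derive1 f u = D u.
  move=> ur; apply: (@derive1_quadratic _ _ _ (r / 4 - rnorm (u - z0)) M).
    by rewrite subr_gt0.
  move=> v vr; apply: H; first exact: ltW.
  by rewrite (le_trans (ler_rdistD u _ _))//; lra.
by exists M; split => // [u ur|u v ur vr]; rewrite DE//;
  [apply: DP|apply: H]; exact: ltW.
Qed.

Lemma analytic_quadratic f z0 : analytic_at f z0 ->
  exists (r M : R), [/\ 0 < r, 0 <= M & forall u v,
    rnorm (u - z0) < r -> rnorm (v - z0) < r ->
    rnorm (f v - f u - (v - u) * derive1 f u) <= M * rnorm (v - u) ^+ 2].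
Proof.
move=> /analytic_power_series[a [r [C fa]]].
have [M [M0 _ H]] := power_series_quadratic fa; exists (r / 4), M; split => //.
by case: fa => r0 _ _; lra.
Qed.

Lemma analytic_derive1 f z0 : analytic_at f z0 -> analytic_at (derive1 f) z0.
Proof.
move=> /analytic_power_series[a [r [C fa]]].
have [M [M0 H _]] := power_series_quadratic fa.
exists (fun n => n.+1%:R * a n.+1); apply/near_rnormP; exists (r / 4) => //.
by case: fa => r0 _ _; lra.
Qed.

(** Only the coefficient of index 0 changes. This transfers analyticity between primitives that
    differ by a local constant. *)
Lemma analytic_addc f g z0 c (r : R) : analytic_at f z0 -> 0 < r ->
  (forall z, rnorm (z - z0) < r -> g z = f z + c) -> analytic_at g z0.
Proof.
move=> [a fa] r0 gf; exists (fun n => if n is 0 then a 0 + c else a n).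
have gfn : \forall z \near z0, g z = f z + c by apply/near_rnormP; exists r.
apply: filterS2 fa gfn => z fz ->.
rewrite -cvg_shiftS.
rewrite [X in X @ _](_ : _ = fun N => series (fun n => a n * (z - z0) ^+ n) N.+1 + c).
  by apply: cvgD; [rewrite -cvg_shiftS in fz|exact: cvg_cst].
apply/funext => N /=; elim: N => [|N ih].
  by rewrite /series/= !big_nat1 expr0; ring.
by rewrite seriesSr ih [in RHS]seriesSr; ring.
Qed.

Lemma natC_neq0 n : n.+1%:R != 0 :> Cplx R.
Proof.
apply/eqP => /(congr1 (fun z : Cplx R => rnorm z)); rewrite rnorm_natr rnorm0.
by move/eqP; rewrite pnatr_eq0.
Qed.

(** Differentiating the termwise primitive returns the power series of [f], so uniqueness of limits
    puts [f] in place of [derive1 G] in the quadratic estimate. In this form [G] can be compared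
    with segment integrals. *)
Lemma analytic_primitive f z0 : analytic_at f z0 ->
  exists (G : Cplx R -> Cplx R) (r M : R), [/\ 0 < r, 0 <= M, analytic_at G z0 &
    forall u v, rnorm (u - z0) < r -> rnorm (v - z0) < r ->
    rnorm (G v - G u - (v - u) * f u) <= M * rnorm (v - u) ^+ 2].
Proof.
move=> /analytic_power_series[a [r [C fa]]].
have C0 := power_series_bound_ge0 fa; case: fa => r0 aC fa.
pose b n := if n is m.+1 then a m / m.+1%:R else 0.
have bC n : rnorm (b n) * r ^+ n <= C * r.
  case: n => [|n] /=; first by rewrite rnorm0 mul0r mulr_ge0// ltW.
  rewrite rnormM rnormV rnorm_natr exprSr mulrA ler_wpM2r ?(ltW r0)//.
  rewrite (le_trans _ (aC n))// ler_wpM2r ?exprn_ge0 ?(ltW r0)//.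
  by rewrite ler_pdivrMr// ler_peMr ?rnorm_ge0// ler1n.
pose G z := lim (series (fun n => b n * (z - z0) ^+ n) @ \oo).
(* Halving the radius bounds the terms by C r / 2^n, so the limit defining [G] exists on the whole
   ball. *)
have Gb : power_series_at G z0 b (r / 2) (C * r).
  split; first by lra.
    move=> n; rewrite (le_trans _ (bC n))// ler_wpM2l ?rnorm_ge0//.
    by rewrite lerXn2r ?nnegrE//; lra.
  move=> z zr; have [n|l] := @cvg_series_half _ (C * r) (fun n => b n * (z - z0) ^+ n).
    rewrite rnormM rnormX.
    have h : rnorm (z - z0) ^+ n <= r ^+ n / 2 ^+ n.
      by rewrite -expr_div_n lerXn2r ?nnegrE ?rnorm_ge0//; lra.
    by rewrite (le_trans (ler_wpM2l (rnorm_ge0 _) h))// mulrA ler_wpM2r ?bC//.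
  by move=> /(cvgP _).
have [M [M0 DG H]] := power_series_quadratic Gb.
have GE u : rnorm (u - z0) < r / 2 / 4 -> derive1 G u = f u.
  move=> ur; have h1 := DG u ur.
  have h2 : series (fun n => a n * (u - z0) ^+ n) @ \oo --> f u by apply: fa; lra.
  apply: (rnorm_cvg_unique h1).
  rewrite [X in series X](_ : _ = fun n => a n * (u - z0) ^+ n)//.
apply/funext => n; congr (_ * _); by rewrite /b mulrC divfK// natC_neq0.
exists G, (r / 2 / 4), M; split => //; [by lra|exact: power_series_analytic Gb|].
by move=> u v ur vr; rewrite -GE//; exact: H.
Qed.

Lemma triangle_sum N a b :
  \sum_(0 <= n < N) \sum_(0 <= i < n.+1) a i * b (n - i)%N =
  \sum_(0 <= i < N) \sum_(0 <= j < N - i) a i * b j.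
Proof.
elim: N => [|N ih]; first by rewrite !big_geq.
rewrite big_nat_recr//= ih [RHS]big_nat_recr//= subSnn big_nat1.
rewrite [in LHS]big_nat_recr//= subnn addrA -big_split/=; congr (_ + _).
by apply: eq_big_nat => i /andP[_ iN]; rewrite subSn ?(ltnW iN)// big_nat_recr.
Qed.

(** The difference consists of the a_i b_j with i, j < N and i + j >= N: at most N^2 terms, each
    bounded by A B / 4^N, and N^2 <= 2^(N+1). *)
Lemma cauchy_product_error (A B : R) a b N :
  (forall n, rnorm (a n) <= A / 4 ^+ n) -> (forall n, rnorm (b n) <= B / 4 ^+ n) ->
  rnorm (series (fun n => \sum_(0 <= i < n.+1) a i * b (n - i)%N) N -
         series a N * series b N) <= 2 * A * B / 2 ^+ N.
Proof.
move=> aA bB.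
have A0 : 0 <= A by have := le_trans (rnorm_ge0 _) (aA 0); rewrite expr0 divr1.
have B0 : 0 <= B by have := le_trans (rnorm_ge0 _) (bB 0); rewrite expr0 divr1.
rewrite {1}/series/= triangle_sum rdistC /series/= big_distrl/= -sumrB.
rewrite (le_trans (ler_rnorm_sum _ _ _))//.
have h (i : nat) : (0 <= i < N)%N -> rnorm (a i * \sum_(0 <= j < N) b j -
    \sum_(0 <= j < N - i) a i * b j) <= N%:R * (A * B / 4 ^+ N).
  move=> /andP[_ iN].
  rewrite (@big_cat_nat _ _ _ (N - i)%N) ?leq_subr//= mulrDr -big_distrr/= addrC addKr.
  rewrite big_distrr/= (le_trans (ler_rnorm_sum _ _ _))//.
  apply: (@le_trans _ _ (\sum_(N - i <= j < N) (A * B / 4 ^+ N))).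
    apply: ler_sum_nat => j /andP[ij jN].
    rewrite rnormM (le_trans (ler_pM _ _ (aA i) (bB j))) ?rnorm_ge0//.
    rewrite mulrACA -invfM -exprD ler_wpM2l ?mulr_ge0//.
    rewrite lef_pV2 ?posrE ?exprn_gt0// ler_weXn2l ?ler1n//.
    by rewrite -leq_subLR.
  rewrite sumr_const_nat -[leLHS]mulr_natl ler_wpM2r ?ler_nat//; last first.
    by rewrite leq_subr.
  by rewrite divr_ge0 ?exprn_ge0// mulr_ge0.
rewrite (le_trans (ler_sum_nat h))//.
apply: (@le_trans _ _ (N%:R ^+ 2 * (A * B / 4 ^+ N))).
  by rewrite sumr_const_nat subn0 expr2 -(mulrA N%:R) !mulr_natl.
have -> : 2 * A * B / 2 ^+ N = 2 ^+ N.+1 * (A * B / 4 ^+ N).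
  have -> : 4 = 2 * 2 :> R by ring.
  have : 2 ^+ N != 0 :> R by rewrite expf_neq0.
  by rewrite exprMn exprS; move: (2 ^+ N) => ? ?; field.
rewrite ler_wpM2r ?sqrn_le_expn// divr_ge0 ?exprn_ge0// mulr_ge0//.
Qed.

Lemma cvg_dist_small (V : normedModType R[i]) (s t : nat -> V) (x : V) :
  s @ \oo --> x ->
  (forall e : R, 0 < e -> \forall n \near \oo, rnorm (t n - s n) < e) ->
  t @ \oo --> x.
Proof.
move=> /cvg_rnormP sx ts; apply/cvg_rnormP => e e0.
have e2 : 0 < e / 2 by lra.
apply: filterS2 (sx _ e2) (ts _ e2) => n h1 h2.
by rewrite (le_lt_trans (ler_rdistD (s n) _ _))//; lra.
Qed.

Lemma cvg_cmul T (F : set_system T) {FF : Filter F} (s t : T -> Cplx R) (x y : Cplx R) :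
  s @ F --> x -> t @ F --> y -> (fun n => s n * t n) @ F --> x * y.
Proof.
move=> /cvg_rnormP sx /cvg_rnormP ty; apply/cvg_rnormP => e e0.
have [x0 y0] := (rnorm_ge0 x, rnorm_ge0 y).
(* [d * K] bounds the three terms of the expansion below; since [d <= 1], the product of the two
   errors is at most [d]. *)
pose K := rnorm x + rnorm y + 1; have K0 : 0 < K by rewrite /K; lra.
pose d := Num.min 1 (e / 2 / K).
have d0 : 0 < d by rewrite lt_min ltr01/= !divr_gt0.
have d1 : d <= 1 by rewrite ge_min lexx.
have dK : d * K <= e / 2 by rewrite -ler_pdivlMr// ge_min lexx orbT.
apply: filterS2 (sx d d0) (ty d d0) => n sn tn.
have -> : s n * t n - x * y = (s n - x) * (t n - y) + (x * (t n - y) + (s n - x) * y).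
  by ring.
rewrite (le_lt_trans (ler_rnormD _ _))//.
rewrite (le_lt_trans (lerD (lexx _) (ler_rnormD _ _)))// !rnormM.
have := rnorm_ge0 (s n - x); have := rnorm_ge0 (t n - y).
rewrite /K in dK; move: (rnorm (s n - x)) (rnorm (t n - y)) sn tn => p q pd qd q0 p0.
have h1 : p * q <= d by rewrite (le_trans (ler_pM p0 q0 (ltW pd) (ltW qd)))// ler_piMr// ltW.
have h2 : rnorm x * q <= rnorm x * d by rewrite ler_wpM2l// ltW.
have h3 : p * rnorm y <= d * rnorm y by rewrite ler_wpM2r// ltW.
nra.
Qed.

(** Within a quarter of the smaller radius the terms of both series decay like 4^-n, the rate that
    [cauchy_product_error] requires; the Cauchy product then has the same limit as the product of
    the partial sums. *)
Lemma analytic_mul f g z0 : analytic_at f z0 -> analytic_at g z0 ->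
  analytic_at (fun z => f z * g z) z0.
Proof.
move=> /analytic_power_series[a [r [A fa]]] /analytic_power_series[b [s [B gb]]].
case: fa => r0 aA fa; case: gb => s0 bB gb.
have minr : Num.min r s <= r by rewrite ge_min lexx.
have mins : Num.min r s <= s by rewrite ge_min lexx orbT.
have d0 : 0 < Num.min r s / 4 by rewrite divr_gt0// lt_min r0.
exists (fun n => \sum_(0 <= i < n.+1) a i * b (n - i)%N).
apply/near_rnormP; exists (Num.min r s / 4) => // z zd.
have bnd (c : nat -> Cplx R) (t C : R) : 0 < t -> Num.min r s <= t ->
    (forall n, rnorm (c n) * t ^+ n <= C) ->
    forall n, rnorm (c n * (z - z0) ^+ n) <= C / 4 ^+ n.
  move=> t0 rst cC n; rewrite rnormM rnormX ler_pdivlMr ?exprn_gt0// -mulrA -exprMn.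
  rewrite (le_trans _ (cC n))// ler_wpM2l ?rnorm_ge0//.
  rewrite lerXn2r ?nnegrE ?mulr_ge0 ?rnorm_ge0//; lra.
have aA' := bnd _ _ _ r0 minr aA.
have bB' := bnd _ _ _ s0 mins bB.
have fz : series (fun n => a n * (z - z0) ^+ n) @ \oo --> f z.
  by apply: fa; lra.
have gz : series (fun n => b n * (z - z0) ^+ n) @ \oo --> g z.
  by apply: gb; lra.
pose P := series (fun n => \sum_(0 <= i < n.+1)
  (a i * (z - z0) ^+ i) * (b (n - i)%N * (z - z0) ^+ (n - i))).
rewrite [X in X @ _](_ : _ = P); last first.
  apply/funext => N; rewrite /P /series/=; apply: eq_bigr => n _.
  rewrite big_distrl/=; apply: eq_big_nat => i /andP[_ iN].
  by rewrite mulrACA -exprD subnKC.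
apply: (cvg_dist_small (cvg_cmul fz gz)) => e e0.
have : (fun N => 2 * A * B * (2^-1) ^+ N) @ \oo --> (0 : R).
by apply: cvg_geometric; rewrite ger0_norm; lra.
move=> /cvgrPdist_lt/(_ e e0); apply: filterS => N.
rewrite sub0r normrN => h.
rewrite (le_lt_trans (cauchy_product_error N aA' bB'))//.
by rewrite -exprVn (le_lt_trans (ler_norm _) h).
Qed.

End analytic.

(** * Complex-valued integrals *)

Section complex_integral.
Variable R : realType.
Local Open Scope complex_scope.

Lemma cReD (z w : Cplx R) : complex.Re (z + w) = complex.Re z + complex.Re w.
Proof. by case: z w => [a b] [c e]. Qed.

Lemma cImD (z w : Cplx R) : complex.Im (z + w) = complex.Im z + complex.Im w.
Proof. by case: z w => [a b] [c e]. Qed.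

Lemma cReB (z w : Cplx R) : complex.Re (z - w) = complex.Re z - complex.Re w.
Proof. by case: z w => [a b] [c e]. Qed.

Lemma cImB (z w : Cplx R) : complex.Im (z - w) = complex.Im z - complex.Im w.
Proof. by case: z w => [a b] [c e]. Qed.

Lemma cReM (z w : Cplx R) :
  complex.Re (z * w) = complex.Re z * complex.Re w - complex.Im z * complex.Im w.
Proof. by case: z w => [a b] [c e]. Qed.

Lemma cImM (z w : Cplx R) :
  complex.Im (z * w) = complex.Re z * complex.Im w + complex.Im z * complex.Re w.
Proof. by case: z w => [a b] [c e]. Qed.

Context d (T : measurableType d) (mu : {measure set T -> \bar R}).
Variables (A : set T).
Hypothesis mA : measurable A.
Implicit Types f g : T -> Cplx R.

Definition cintegrable f :=
  mu.-integrable A (fun x => (complex.Re (f x))%:E) /\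
  mu.-integrable A (fun x => (complex.Im (f x))%:E).

Let integrable_EFinZ r (g : T -> R) : mu.-integrable A (fun x => (g x)%:E) ->
  mu.-integrable A (fun x => (r * g x)%:E).
Proof. by move=> ig; exact: (@integrableZl _ _ _ mu A mA r _ ig). Qed.

Lemma eq_cintegral f g : (forall x, A x -> f x = g x) ->
  cintegral mu A f = cintegral mu A g.
Proof.
by move=> fg; congr (_ +i* _); apply: eq_Rintegral => x /set_mem/fg ->.
Qed.

Lemma cintegrableZ c f : cintegrable f -> cintegrable (fun x => c * f x).
Proof.
move=> [f1 f2]; split.
- under eq_fun do rewrite cReM; apply: (@integrableB _ _ _ mu A mA
    (fun x => (complex.Re c * complex.Re (f x))%:E)
    (fun x => (complex.Im c * complex.Im (f x))%:E));
  exact: integrable_EFinZ.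
- under eq_fun do rewrite cImM; apply: (@integrableD _ _ _ mu A mA
    (fun x => (complex.Re c * complex.Im (f x))%:E)
    (fun x => (complex.Im c * complex.Re (f x))%:E)); exact: integrable_EFinZ.
Qed.

Lemma cintegrableB f g : cintegrable f -> cintegrable g ->
  cintegrable (fun x => f x - g x).
Proof.
move=> [f1 f2] [g1 g2]; split.
- by under eq_fun do rewrite cReB; exact: (@integrableB _ _ _ mu A mA
    (fun x => (complex.Re (f x))%:E) (fun x => (complex.Re (g x))%:E)).
- by under eq_fun do rewrite cImB; exact: (@integrableB _ _ _ mu A mA
    (fun x => (complex.Im (f x))%:E) (fun x => (complex.Im (g x))%:E)).
Qed.

Lemma cintegralD f g : cintegrable f -> cintegrable g ->
  cintegral mu A (fun x => f x + g x) = cintegral mu A f + cintegral mu A g.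
Proof.
move=> [f1 f2] [g1 g2]; rewrite /cintegral.
rewrite (_ : _ + _ = (\int[mu]_(x in A) complex.Re (f x) + \int[mu]_(x in A) complex.Re (g x)) +i*
   (\int[mu]_(x in A) complex.Im (f x) + \int[mu]_(x in A) complex.Im (g x)))//.
by congr (_ +i* _); [under eq_Rintegral do rewrite cReD|
  under eq_Rintegral do rewrite cImD]; rewrite RintegralD.
Qed.

Lemma cintegralB f g : cintegrable f -> cintegrable g ->
  cintegral mu A (fun x => f x - g x) = cintegral mu A f - cintegral mu A g.
Proof.
move=> [f1 f2] [g1 g2]; rewrite /cintegral.
rewrite (_ : _ - _ = (\int[mu]_(x in A) complex.Re (f x) - \int[mu]_(x in A) complex.Re (g x)) +i*
   (\int[mu]_(x in A) complex.Im (f x) - \int[mu]_(x in A) complex.Im (g x)))//.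
by congr (_ +i* _); [under eq_Rintegral do rewrite cReB|
  under eq_Rintegral do rewrite cImB]; rewrite RintegralB.
Qed.

Lemma cintegralZ c f : cintegrable f ->
  cintegral mu A (fun x => c * f x) = c * cintegral mu A f.
Proof.
case: c => a b [f1 f2]; rewrite /cintegral /=.
have Z1 r : mu.-integrable A (fun x => (r * complex.Re (f x))%:E).
  exact: integrable_EFinZ.
have Z2 r : mu.-integrable A (fun x => (r * complex.Im (f x))%:E).
  exact: integrable_EFinZ.
apply/eqP; rewrite eq_complex/=; apply/andP; split; apply/eqP.
- under eq_Rintegral do rewrite cReM/=.
  by rewrite (RintegralB mA (Z1 a) (Z2 b)) (RintegralZl a mA f1) (RintegralZl b mA f2).
- under eq_Rintegral do rewrite cImM/=.
  by rewrite (RintegralD mA (Z2 a) (Z1 b)) (RintegralZl a mA f2) (RintegralZl b mA f1).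
Qed.

(* The factor [2] comes from bounding real and imaginary parts separately. *)
Lemma cintegral_le f (h : T -> R) : cintegrable f ->
  mu.-integrable A (EFin \o h) -> (forall x, A x -> rnorm (f x) <= h x) ->
  rnorm (cintegral mu A f) <= 2 * \int[mu]_(x in A) h x.
Proof.
move=> [f1 f2] ih fh; rewrite (le_trans (rnorm_le_ReIm _))//= mulr_natl mulr2n.
have aint (g : T -> R) : mu.-integrable A (fun x => (g x)%:E) ->
    mu.-integrable A (fun x => (`|g x|)%:E) by move=> /integrable_abse.
apply: lerD; rewrite (le_trans (le_normr_Rintegral _ _))//;
  apply: le_Rintegral => //; first exact: aint.
- by move=> x Ax; rewrite (le_trans (Re_le_rnorm _))// fh.
- exact: aint.
- by move=> x Ax; rewrite (le_trans (Im_le_rnorm _))// fh.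
Qed.

End complex_integral.

(** * Integrals over the unit interval *)

Section segment_integrals.
Variable R : realType.
Local Open Scope complex_scope.
Let leb : {measure set (measurableTypeR R) -> \bar R} := @lebesgue_measure R.
Let I01 : set R := `[0, 1]%classic.

Lemma I01_measurable : measurable (I01 : set (measurableTypeR R)).
Proof. exact: measurable_itv. Qed.
Let mI := I01_measurable.

Lemma I01_measure1 : fine (leb I01) = 1.
Proof. by rewrite /leb/= lebesgue_measure_itv/= lte_fin ltr01 oppr0 adde0. Qed.

Lemma cintegrable01 (f : R -> Cplx R) :
  (forall t : R, 0 <= t <= 1 -> f @ t --> f t) -> cintegrable leb I01 f.
Proof.
move=> fc.
have part (g : Cplx R -> R) : (forall z w, `|g z - g w| <= rnorm (z - w)) ->
    leb.-integrable I01 (fun x => (g (f x))%:E).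
  move=> gr; apply: (@continuous_compact_integrable R (g \o f)).
    exact: segment_compact.
  apply: continuous_in_subspaceT => t /set_mem; rewrite /I01/= in_itv/= => t01.
  apply/cvgrPdist_lt => e e0; have /cvg_rnormP/(_ e e0) := fc t t01.
  by apply: filterS => s /= h; rewrite distrC (le_lt_trans (gr _ _)).
split; apply: part => z w.
- by rewrite -cReB Re_le_rnorm.
- by rewrite -cImB Im_le_rnorm.
Qed.

Lemma cintegral01_le (f : R -> Cplx R) (M : R) :
  (forall t : R, 0 <= t <= 1 -> f @ t --> f t) ->
  (forall t : R, 0 <= t <= 1 -> rnorm (f t) <= M) ->
  rnorm (cintegral leb I01 f) <= 2 * M.
Proof.
move=> fc fM.
have iM : leb.-integrable I01 (EFin \o cst M).
  apply: (@continuous_compact_integrable R (cst M)); first exact: segment_compact.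
  by apply: continuous_subspaceT => x; exact: cvg_cst.
have := cintegral_le mI (cintegrable01 fc) iM; rewrite (Rintegral_cst leb mI M).
by rewrite I01_measure1 mulr1; apply => t /=; rewrite /I01/= in_itv/=; exact: fM.
Qed.

Lemma is_derive_quadratic (G : R -> R) t (D r M : R) : 0 < r ->
  (forall s, `|s - t| < r -> `|G s - G t - (s - t) * D| <= M * (s - t) ^+ 2) ->
  is_derive t 1 G D.
Proof.
move=> r0 H.
suff h : h^-1 *: ((G \o shift t) (h *: 1) - G t) @[h --> 0^'] --> D.
  split; first by apply/cvg_ex; exists D.
  by rewrite /derive; apply: cvg_lim h.
apply/cvgrPdist_lt => e e0.
have M0 : 0 < `|M| + 1 by rewrite (le_lt_trans (normr_ge0 M))// ltrDl.
have d0 : 0 < Num.min r (e / (`|M| + 1)) by rewrite lt_min r0 divr_gt0.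
have hA : \forall h \near (0 : R)^', `|h| < Num.min r (e / (`|M| + 1)).
  exact: dnbhs0_lt.
have hB : \forall h \near (0 : R)^', h != 0 := nbhs_dnbhs_neq 0.
apply: filterS2 hA hB => h + h0; rewrite lt_min => /andP[hr he].
have hn0 : 0 < `|h| by rewrite normr_gt0.
have := H (h + t); rewrite addrK => /(_ hr) H1.
rewrite distrC /= [h%:A]mulr1.
have -> : h^-1 *: (G (h + t) - G t) - D = h^-1 * (G (h + t) - G t - h * D).
  by rewrite [RHS]mulrBr mulrA mulVf// mul1r.
rewrite normrM normfV mulrC ltr_pdivrMr// (le_lt_trans H1)// -real_normK ?num_real// expr2 mulrA.
rewrite ltr_pM2r// (le_lt_trans (ler_wpM2r (ltW hn0) (ler_norm M)))//.
rewrite ltr_pdivlMr// in he; rewrite (le_lt_trans _ he)// mulrC ler_pM2l// lerDl//.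
Qed.

End segment_integrals.

(** * Primitives along segments *)

Section segment_primitive.
Variable R : realType.
Local Open Scope complex_scope.
Local Notation leb := (@lebesgue_measure R).
Local Notation I01 := (`[0, 1]%classic : set R).

(** The estimate is required for all [s] near [t], also outside [0, 1], so [G] is differentiable at
    the endpoints as well; this supplies the one-sided continuity in the fundamental theorem. *)
Lemma ftc_quadratic (G D : R -> R) :
  (forall t : R, 0 <= t <= 1 -> D @ t --> D t) ->
  (forall t : R, 0 <= t <= 1 -> exists (r M : R), 0 < r /\
     forall s, `|s - t| < r -> `|G s - G t - (s - t) * D t| <= M * (s - t) ^+ 2) ->
  \int[leb]_(t in I01) D t = G 1 - G 0.
Proof.
move=> cD GD.
have dG (t : R) : 0 <= t <= 1 -> is_derive t 1 G (D t).
  by move=> /GD[r [M [r0 H]]]; exact: is_derive_quadratic r0 H.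
have cG (t : R) : 0 <= t <= 1 -> {for t, continuous G}.
  by move=> /dG[/derivable1_diffP/differentiable_continuous].
rewrite /Rintegral (@continuous_FTC2 R D G 0 1)//.
- apply: continuous_in_subspaceT => t /set_mem; rewrite /= in_itv/=; exact: cD.
- split.
  + by move=> t; rewrite in_itv/= => /andP[t0 t1]; have [] := dG t; rewrite ?ltW.
  + by apply: cvg_at_right_filter; apply: cG; rewrite lexx ler01.
  + by apply: cvg_at_left_filter; apply: cG; rewrite lexx ler01.
- move=> t; rewrite in_itv/= => /andP[t0 t1]; rewrite derive1E.
  by have [] := dG t; rewrite ?ltW.
Qed.

Lemma cftc_quadratic (G D : R -> Cplx R) :
  (forall t : R, 0 <= t <= 1 -> D @ t --> D t) ->
  (forall t : R, 0 <= t <= 1 -> exists (r M : R), 0 < r /\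
     forall s, `|s - t| < r ->
       rnorm (G s - G t - (s - t)%:C * D t) <= M * (s - t) ^+ 2) ->
  cintegral leb I01 D = G 1 - G 0.
Proof.
move=> cD GD; apply/eqP; rewrite eq_complex/= !(cReB, cImB).
apply/andP; split; apply/eqP.
- apply: (@ftc_quadratic (fun t => complex.Re (G t))) => t t01.
    apply/cvgrPdist_lt => e e0; have /cvg_rnormP/(_ e e0) := cD t t01.
    by apply: filterS => s /= h; rewrite distrC -cReB (le_lt_trans (Re_le_rnorm _)).
  have [r [M [r0 H]]] := GD t t01; exists r, M; split => // s /H.
  by apply: le_trans; rewrite (le_trans _ (Re_le_rnorm _))// !cReB cReM/= mul0r subr0.
- apply: (@ftc_quadratic (fun t => complex.Im (G t))) => t t01.
    apply/cvgrPdist_lt => e e0; have /cvg_rnormP/(_ e e0) := cD t t01.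
    by apply: filterS => s /= h; rewrite distrC -cImB (le_lt_trans (Im_le_rnorm _)).
  have [r [M [r0 H]]] := GD t t01; exists r, M; split => // s /H.
  by apply: le_trans; rewrite (le_trans _ (Im_le_rnorm _))// !cImB cImM/= mul0r addr0.
Qed.

(** Compactness merges constants that work near each point into one for the whole segment. All
    constants are encoded in a single natural number, which is why [P] must hold locally for every
    large [n]. *)
Lemma segment_uniform (P : nat -> R -> Prop) :
  (forall s : R, 0 <= s <= 1 -> exists (r : R) (N : nat), 0 < r /\
     forall t n, `|t - s| < r -> (N <= n)%N -> P n t) ->
  exists N : nat, forall s, 0 <= s <= 1 -> P N s.
Proof.
move=> H; have /compact_near_coveringP cK := @segment_compact R 0 1.
have /(cK nat eventually P) : forall x : R, `[0, 1]%classic x ->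
    \forall x' \near x & n \near \oo, P n x'.
  move=> s /=; rewrite in_itv/= => /H[r [N [r0 HN]]].
  exists ([set t | `|t - s| < r], [set n | (N <= n)%N]) => /=.
    split; last by exists N.
    by apply/nbhs_ballP; exists r => // t; rewrite /ball/= distrC.
  by move=> [t n] /= [? ?]; exact: HN.
move=> [N _ HN]; exists N => s s01.
by apply: (HN N) => //=; rewrite in_itv.
Qed.

End segment_primitive.

(** * Segment integrals as functions of their endpoint *)

Section segment_analytic.
Variable R : realType.
Local Open Scope complex_scope.
Local Notation leb := (@lebesgue_measure R).
Local Notation I01 := (`[0, 1]%classic : set R).
Implicit Types (f : Cplx R -> Cplx R) (z u v : Cplx R).

Lemma cvg_at_rnormP (V W : normedModType R[i]) (f : V -> W) (x : V) (l : W) :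
  f @ x --> l <-> forall e : R, 0 < e -> exists2 r : R, 0 < r &
    forall y, rnorm (y - x) < r -> rnorm (f y - l) < e.
Proof.
split=> [/(@cvg_rnormP _ _ _ (nbhs x)) H e /H /near_rnormP //|H].
by apply/(@cvg_rnormP _ _ _ (nbhs x)) => e /H h; apply/near_rnormP.
Qed.

Lemma cvg_real_rnormP (W : normedModType R[i]) (f : R -> W) (x : R) (l : W) :
  f @ x --> l <-> forall e : R, 0 < e -> exists2 r : R, 0 < r &
    forall y, `|y - x| < r -> rnorm (f y - l) < e.
Proof.
split=> [/(@cvg_rnormP _ _ _ (nbhs x)) H e /H /nbhs_ballP[r r0 h]|H].
  by exists r => // y yx; apply: h; rewrite /ball/= distrC.
apply/(@cvg_rnormP _ _ _ (nbhs x)) => e /H [r r0 h]; apply/nbhs_ballP.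
by exists r => // y; rewrite /ball/= distrC; exact: h.
Qed.

Lemma segment_in_disc z (t : R) : unit_disc z -> 0 <= t <= 1 ->
  unit_disc (t%:C * z).
Proof.
move=> /unit_discE z1 /andP[t0 t1]; apply/unit_discE.
rewrite rnormM rnorm_real ger0_norm// (le_lt_trans _ z1)//.
by rewrite ler_piMl// rnorm_ge0.
Qed.

Lemma analytic_continuous f z : analytic_at f z -> f @ z --> f z.
Proof.
move=> /analytic_quadratic[r [M [r0 M0 H]]]; apply/cvg_at_rnormP => e e0.
set D := derive1 f z in H; have D0 := rnorm_ge0 D.
have K0 : 0 < M + rnorm D + 1 by lra.
exists (Num.min (Num.min r 1) (e / (M + rnorm D + 1))).
  by rewrite !lt_min r0 ltr01 divr_gt0.
move=> y; rewrite !lt_min => /andP[/andP[yr y1] ye].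
have := H z y; rewrite subrr rnorm0 => /(_ r0 yr) h.
have -> : f y - f z = (f y - f z - (y - z) * D) + (y - z) * D by rewrite subrK.
rewrite (le_lt_trans (ler_rnormD _ _))// rnormM (le_lt_trans (lerD h (lexx _)))//.
rewrite ltr_pdivlMr// in ye; have := rnorm_ge0 (y - z).
rewrite -/D; move: (rnorm (y - z)) (rnorm D) D0 y1 ye {h K0} => p q q0 p1 pe p0.
have : M * p ^+ 2 <= M * p by rewrite ler_wpM2l// expr2 ler_piMl// ltW.
by lra.
Qed.

Lemma cvg_segment f z (t : R) : analytic_at f (t%:C * z) ->
  (fun s : R => f (s%:C * z)) @ t --> f (t%:C * z).
Proof.
move=> /analytic_continuous/cvg_at_rnormP fc.
apply/cvg_real_rnormP => e /fc [r r0 H].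
have z1 : 0 < rnorm z + 1 by rewrite ltr_wpDl ?rnorm_ge0.
exists (r / (rnorm z + 1)) => /=; first by rewrite divr_gt0.
move=> s; rewrite ltr_pdivlMr// => h; apply: H.
have -> : s%:C * z - t%:C * z = (s - t)%:C * z by rewrite rmorphB mulrBl.
rewrite rnormM rnorm_real (le_lt_trans _ h)// ler_wpM2l// lerDl//.
Qed.

Lemma cvg_real_complex (t : R) :
  (fun s : R => s%:C : Cplx R) @ t --> (t%:C : Cplx R).
Proof.
apply/cvg_real_rnormP => e e0; exists e => //= s.
by rewrite -rmorphB/= rnorm_real.
Qed.

Lemma segment_bounded f z : analytic_on_disc f -> unit_disc z ->
  exists B : R, forall t : R, 0 <= t <= 1 -> rnorm (f (t%:C * z)) <= B.
Proof.
move=> fa zD; suff [N HN] : exists N : nat, forall t : R, 0 <= t <= 1 ->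
  rnorm (f (t%:C * z)) <= N%:R by exists N%:R.
apply: (@segment_uniform R (fun n t => rnorm (f (t%:C * z)) <= n%:R)) => s s01.
have /cvg_segment/cvg_real_rnormP/(_ 1 ltr01) := fa _ (segment_in_disc zD s01).
move=> [r r0 H].
have b0 : 0 <= rnorm (f (s%:C * z)) + 1 by rewrite addr_ge0 ?rnorm_ge0.
exists r, (Num.bound (rnorm (f (s%:C * z)) + 1)); split => // t n ts Nn.
have h := H _ ts.
apply: (@le_trans _ _ (Num.bound (rnorm (f (s%:C * z)) + 1))%:R); last by rewrite ler_nat.
rewrite (le_trans _ (ltW (archi_boundP b0)))//.
rewrite -(subrK (f (s%:C * z)) (f (t%:C * z))) (le_trans (ler_rnormD _ _))//.
rewrite addrC lerD2l ltW//.
Qed.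

(** Compactness of the segment makes both constants independent of [t]. One number N stands for the
    two of them, as the bound N and the radius 1 / (N + 1). *)
Lemma segment_quadratic f z : analytic_on_disc f -> unit_disc z ->
  exists r M : R, [/\ 0 < r, 0 <= M & forall (t : R) v, 0 <= t <= 1 ->
    rnorm (v - t%:C * z) < r ->
    rnorm (f v - f (t%:C * z) - (v - t%:C * z) * derive1 f (t%:C * z)) <=
      M * rnorm (v - t%:C * z) ^+ 2].
Proof.
move=> fa zD.
suff [N HN] : exists N : nat, forall t : R, 0 <= t <= 1 -> forall v,
    rnorm (v - t%:C * z) < N.+1%:R^-1 ->
    rnorm (f v - f (t%:C * z) - (v - t%:C * z) * derive1 f (t%:C * z)) <=
      N%:R * rnorm (v - t%:C * z) ^+ 2.
  by exists N.+1%:R^-1, N%:R; split => // t v t01; exact: HN.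
apply: (@segment_uniform R (fun n t => forall v,
    rnorm (v - t%:C * z) < n.+1%:R^-1 ->
    rnorm (f v - f (t%:C * z) - (v - t%:C * z) * derive1 f (t%:C * z)) <=
      n%:R * rnorm (v - t%:C * z) ^+ 2)) => s s01.
have /analytic_quadratic[r [M [r0 M0 H]]] := fa _ (segment_in_disc zD s01).
have r20 : 0 < r / 2 by lra.
have b0 : 0 <= M + (r / 2)^-1 by rewrite addr_ge0// invr_ge0 ltW.
(* Any n above M + 2 / r exceeds the local bound M and satisfies 1 / (n + 1) < r / 2; the other half
   of r pays for moving from [s] to [t]. *)
exists (r / 2), (Num.bound (M + (r / 2)^-1)); split => // t n ts Nn v vt.
have Mn : M + (r / 2)^-1 < n%:R.
  by rewrite (lt_le_trans (archi_boundP b0))// ler_nat.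
have rn : n.+1%:R^-1 < r / 2.
  rewrite invf_plt ?posrE// (@lt_le_trans _ _ n%:R) ?ler_nat//.
  by rewrite (le_lt_trans _ Mn)// lerDr.
have tsr : rnorm (t%:C * z - s%:C * z : Cplx R) < r / 2.
  have -> : t%:C * z - s%:C * z = (t - s)%:C * z by rewrite rmorphB mulrBl.
  rewrite rnormM rnorm_real (le_lt_trans _ ts)// ler_piMr//.
  by apply: ltW; apply/unit_discE.
have rr : r / 2 < r by lra.
have vsr : rnorm (v - s%:C * z : Cplx R) < r.
  rewrite (le_lt_trans (ler_rdistD (t%:C * z : Cplx R) _ _))//.
  by rewrite [r in ltRHS]splitr ltrD// (lt_trans vt rn).
rewrite (le_trans (H _ _ (lt_trans tsr rr) vsr))//.
rewrite ler_wpM2r ?sqr_ge0// ltW// (le_lt_trans _ Mn)// lerDl invr_ge0 ltW//.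
Qed.

(* Subtracting f(z) = \int_0^1 (t f(tz))' dt makes the integrand O(|h|^2), uniformly
   in t. *)
Lemma segment_integral_deriv f z : analytic_on_disc f -> unit_disc z ->
  exists r M : R, [/\ 0 < r, 0 <= M & forall h : Cplx R, rnorm h < r ->
    rnorm (segment_integral f (z + h) - segment_integral f z - h * f z) <=
      M * rnorm h ^+ 2].
Proof.
move=> fa zD; have [r [M [r0 M0 H]]] := segment_quadratic fa zD.
have f'a : analytic_on_disc (derive1 f) by move=> w wD; exact/analytic_derive1/fa.
have [B HB] := segment_bounded f'a zD.
have B0 : 0 <= B.
  by rewrite (le_trans _ (HB 0 _)) ?rnorm_ge0// lexx ler01.
have z1 : 0 < 1 - rnorm z by rewrite subr_gt0; exact/unit_discE.
have zlt1 : rnorm z < 1 by lra.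
(* The radius keeps z + h in the disc and |h| below 1. The outer 2 is that of [cintegral01_le]; the
   Taylor remainder of f contributes [M] twice, multiplied by z and by h, and [B] bounds f' on the
   segment. *)
exists (Num.min (Num.min r 1) (1 - rnorm z)), (2 * (M + M + B)); split.
- by rewrite !lt_min r0 ltr01 z1.
- by rewrite mulr_ge0// !addr_ge0.
move=> h; rewrite !lt_min => /andP[/andP[hr h1] hz].
have zhD : unit_disc (z + h).
  by apply/unit_discE; rewrite (le_lt_trans (ler_rnormD _ _))//; lra.
have cf t (t01 : 0 <= t <= 1) := cvg_segment (fa _ (segment_in_disc zD t01)).
have cf' t (t01 : 0 <= t <= 1) := cvg_segment (f'a _ (segment_in_disc zD t01)).
have cfh t (t01 : 0 <= t <= 1) := cvg_segment (fa _ (segment_in_disc zhD t01)).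
pose D t := f (t%:C * z) + t%:C * z * derive1 f (t%:C * z).
have cD (t : R) : 0 <= t <= 1 -> D @ t --> D t.
  move=> t01; apply: cvgD; first exact: cf.
  apply: cvg_cmul; last exact: cf'.
  by apply: cvg_cmul; [exact: cvg_real_complex|exact: cvg_cst].
have iD := cintegrable01 cD.
have if1 := cintegrable01 cf. have if2 := cintegrable01 cfh.
have ftc : cintegral leb I01 D = f z.
  rewrite (@cftc_quadratic _ (fun t => t%:C * f (t%:C * z)))//; last first.
    (* [s] may leave the unit interval, but |s - t| < 1 gives |s| <= 2, the factor of [M]; [B]
       bounds the term with (s - t)^2 f'. *)
    move=> t t01; exists (Num.min r 1), (2 * M + B).
    split=> [|s]; first by rewrite lt_min r0 ltr01.
    rewrite lt_min => /andP[sr s1].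
    have -> : s%:C * f (s%:C * z) - t%:C * f (t%:C * z) - (s - t)%:C * D t =
        s%:C * (f (s%:C * z) - f (t%:C * z) -
                (s%:C * z - t%:C * z) * derive1 f (t%:C * z)) +
        (s - t)%:C * (s - t)%:C * (z * derive1 f (t%:C * z)).
      by rewrite /D rmorphB/=; ring.
    have stz : rnorm (s%:C * z - t%:C * z : Cplx R) <= `|s - t|.
      by rewrite -mulrBl -rmorphB/= rnormM rnorm_real ler_piMr// ltW.
    have hs := H t (s%:C * z) t01 (le_lt_trans stz sr).
    have h2 : rnorm (s%:C * z - t%:C * z : Cplx R) ^+ 2 <= (s - t) ^+ 2.
      by rewrite -[leRHS]real_normK ?num_real// lerXn2r ?nnegrE ?rnorm_ge0.
    have s2 : rnorm (s%:C : Cplx R) <= 2.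
      rewrite rnorm_real -(subrK t s) (le_trans (ler_normD _ _))//.
      by rewrite (ger0_norm (andP t01).1); case/andP: t01 => _ ?; lra.
    rewrite (le_trans (ler_rnormD _ _))// [leRHS]mulrDl; apply: lerD.
      rewrite rnormM -mulrA ler_pM ?rnorm_ge0// (le_trans hs)//.
      by rewrite ler_wpM2l.
    rewrite !rnormM rnorm_real -expr2 real_normK ?num_real// mulrC ler_wpM2r ?sqr_ge0//.
    by rewrite -[leRHS]mul1r ler_pM ?rnorm_ge0 ?HB// ltW.
  by rewrite mul1r mul0r subr0 mul1r.
rewrite /segment_integral -ftc.
have iz1 := cintegrableZ (@I01_measurable R) (z + h) if2.
have iz2 := cintegrableZ (@I01_measurable R) z if1.
have iz3 := cintegrableZ (@I01_measurable R) h iD.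
have iz4 := cintegrableB (@I01_measurable R) iz1 iz2.
rewrite -(cintegralZ (@I01_measurable R) _ if2) -(cintegralZ (@I01_measurable R) _ if1).
rewrite -(cintegralZ (@I01_measurable R) _ iD).
rewrite -(cintegralB (@I01_measurable R) iz1 iz2) -(cintegralB (@I01_measurable R) iz4 iz3).
rewrite -mulrA; apply: cintegral01_le => t t01.
  apply: cvgB; last by apply: cvg_cmul; [exact: cvg_cst|exact: cD].
  apply: cvgB; apply: cvg_cmul; [exact: cvg_cst|exact: cfh|exact: cvg_cst|exact: cf].
set p := t%:C * z; have tzh : t%:C * (z + h) - p = t%:C * h by rewrite /p; ring.
have th : rnorm (t%:C * h : Cplx R) <= rnorm h.
  rewrite rnormM rnorm_real ger0_norm; last by case/andP: t01.
  by rewrite ler_piMl ?rnorm_ge0//; case/andP: t01.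
have := H t (t%:C * (z + h)) t01; rewrite -/p tzh => /(_ (le_lt_trans th hr)) hq.
have fB : rnorm (derive1 f p) <= B by exact: HB.
have -> : (z + h) * f (t%:C * (z + h)) - z * f p - h * D t =
    z * (f (t%:C * (z + h)) - f p - t%:C * h * derive1 f p) +
    h * ((f (t%:C * (z + h)) - f p - t%:C * h * derive1 f p) + t%:C * h * derive1 f p).
  by rewrite /D /p; ring.
have th2 : rnorm (t%:C * h : Cplx R) ^+ 2 <= rnorm h ^+ 2.
  by rewrite lerXn2r ?nnegrE ?rnorm_ge0.
have hq' := le_trans hq (ler_wpM2l M0 th2).
rewrite (le_trans (ler_rnormD _ _))// [leRHS]mulrDl [in leRHS]mulrDl -[leRHS]addrA; apply: lerD.
  by rewrite rnormM -[leRHS]mul1r ler_pM ?rnorm_ge0// ltW.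
rewrite rnormM -[leRHS]mulrDl [leRHS]mulrC expr2 -[leRHS]mulrA ler_wpM2l ?rnorm_ge0//.
rewrite (le_trans (ler_rnormD _ _))// [leRHS]mulrDr; apply: lerD.
  rewrite (le_trans hq')// expr2 [leRHS]mulrC ler_wpM2l//.
  by rewrite ler_piMr ?rnorm_ge0// ltW.
by rewrite rnormM ler_pM ?rnorm_ge0.
Qed.

Lemma analytic_segment_integral f : analytic_on_disc f ->
  analytic_on_disc (segment_integral f).
Proof.
move=> fa z0 z0D.
have [G [r [M [r0 M0 Ga HG]]]] := analytic_primitive (fa z0 z0D).
have z1 : 0 < 1 - rnorm z0 by rewrite subr_gt0; exact/unit_discE.
have [rho rho0 [rhor rho1]] : exists2 rho : R, 0 < rho &
    rho <= r /\ rho <= 1 - rnorm z0.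
  exists (Num.min r (1 - rnorm z0)); first by rewrite lt_min r0 z1.
  by split; rewrite ge_min lexx ?orbT.
apply: (@analytic_addc _ G _ _ (segment_integral f z0 - G z0) rho) => // u ur.
pose E w := segment_integral f w - G w.
suff : E u = E z0.
  by rewrite /E => /eqP; rewrite subr_eq => /eqP ->; rewrite addrC.
pose q (t : R) := z0 + t%:C * (u - z0).
have qz0 (t : R) : 0 <= t <= 1 -> rnorm (q t - z0) <= rnorm (u - z0).
  move=> /andP[t0 t1]; rewrite /q addrC addKr rnormM rnorm_real ger0_norm//.
  by rewrite ler_piMl ?rnorm_ge0.
have ballD w : rnorm (w - z0) < rho -> unit_disc w.
  move=> wr; apply/unit_discE; rewrite -(subrK z0 w).
  by rewrite (le_lt_trans (ler_rnormD _ _))//; lra.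
(* [E] is a difference of two primitives of f: the linear terms cancel, so along the segment from
   [z0] to [u] it satisfies the quadratic estimate with derivative 0. *)
have : cintegral leb I01 (fun=> (0 : Cplx R)) = E (q 1) - E (q 0).
  apply: (@cftc_quadratic _ (fun t => E (q t))) => t t01; first exact: cvg_cst.
  have qt : rnorm (q t - z0) < rho by rewrite (le_lt_trans (qz0 _ t01)).
  have [r1 [M1 [r10 M10 H1]]] := segment_integral_deriv fa (ballD _ qt).
  exists (Num.min r1 (rho - rnorm (u - z0))), (M1 + M).
  split=> [|s]; first by rewrite lt_min r10 subr_gt0.
  rewrite lt_min => /andP[sr1 sr2].
  have u1 : rnorm (u - z0) <= 1.
    by rewrite (le_trans (ltW ur))// (le_trans rho1)// gerBl rnorm_ge0.
  pose h : Cplx R := (s - t)%:C * (u - z0).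
  have qs : q s = q t + h by rewrite /q /h rmorphB/=; ring.
  have hst : rnorm h <= `|s - t| by rewrite rnormM rnorm_real ler_piMr.
  have h2 : rnorm h ^+ 2 <= (s - t) ^+ 2.
    by rewrite -[leRHS]real_normK ?num_real// lerXn2r ?nnegrE ?rnorm_ge0.
  rewrite mulr0 subr0 qs.
  have e1 := H1 h (le_lt_trans hst sr1).
  have qh : rnorm (q t + h - z0) < rho.
    rewrite addrAC (le_lt_trans (ler_rnormD _ _))//.
    by rewrite (le_lt_trans (lerD (qz0 _ t01) hst))//; lra.
  have := HG (q t) (q t + h) (lt_le_trans qt rhor) (lt_le_trans qh rhor).
  rewrite [q t + h - q t]addrC addKr => e2.
  have -> : E (q t + h) - E (q t) =
     (segment_integral f (q t + h) - segment_integral f (q t) - h * f (q t)) -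
     (G (q t + h) - G (q t) - h * f (q t)) by rewrite /E; ring.
  rewrite (le_trans (ler_rnormB _ _))// (le_trans (lerD e1 e2))// -mulrDl.
  by rewrite ler_wpM2l// addr_ge0.
have q0 : q 0 = z0 by rewrite /q rmorph0 mul0r addr0.
have q1 : q 1 = u by rewrite /q rmorph1 mul1r addrC subrK.
rewrite q0 q1 /cintegral /= /Rintegral integral0/=.
by move=> /esym/eqP; rewrite subr_eq0 => /eqP.
Qed.

End segment_analytic.

(** * Fubini for kernels *)

Section measurability.
Variable R : realType.
Local Open Scope complex_scope.

Section closure.
Context d (T : measurableType d).
Implicit Types f g : T -> Cplx R.

Lemma cmeasurable_cst c : cmeasurable (fun _ : T => c : Cplx R).
Proof. by split; exact: measurable_cst. Qed.

Lemma cmeasurable_real (r : T -> R) : measurable_fun setT r ->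
  cmeasurable (fun x => (r x)%:C : Cplx R).
Proof. by move=> mr; split => //=; exact: measurable_cst. Qed.

Lemma cmeasurableD f g : cmeasurable f -> cmeasurable g ->
  cmeasurable (fun x => f x + g x).
Proof.
by move=> [f1 f2] [g1 g2]; split; [under eq_fun do rewrite cReD|
  under eq_fun do rewrite cImD]; exact: measurable_funD.
Qed.

Lemma cmeasurableB f g : cmeasurable f -> cmeasurable g ->
  cmeasurable (fun x => f x - g x).
Proof.
by move=> [f1 f2] [g1 g2]; split; [under eq_fun do rewrite cReB|
  under eq_fun do rewrite cImB]; exact: measurable_funB.
Qed.

Lemma cmeasurableM f g : cmeasurable f -> cmeasurable g ->
  cmeasurable (fun x => f x * g x).
Proof.
move=> [f1 f2] [g1 g2]; split.
  by under eq_fun do rewrite cReM; apply: measurable_funB; exact: measurable_funM.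
by under eq_fun do rewrite cImM; apply: measurable_funD; exact: measurable_funM.
Qed.

Lemma cmeasurable_conj f : cmeasurable f ->
  cmeasurable (fun x => (f x)^* : Cplx R).
Proof.
move=> [f1 f2]; split.
- rewrite (_ : (fun x => _) = fun x => complex.Re (f x))//.
  by apply/funext => x; case: (f x).
- rewrite (_ : (fun x => _) = fun x => - complex.Im (f x)).
    exact: measurableT_comp.
  by apply/funext => x; case: (f x).
Qed.

Lemma measurable_rnorm f : cmeasurable f ->
  measurable_fun setT (fun x => rnorm (f x)).
Proof.
move=> [f1 f2]; under eq_fun do rewrite rnormE.
have ms : measurable_fun [set: R] (@Num.sqrt R).
  by apply: continuous_measurable_fun; exact: sqrt_continuous.
have mf : measurable_fun setT
    (fun x => complex.Re (f x) ^+ 2 + complex.Im (f x) ^+ 2).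
  by apply: measurable_funD; apply: measurable_funX.
exact: (measurableT_comp ms mf).
Qed.

End closure.

Lemma cmeasurable_comp d d' (T : measurableType d) (U : measurableType d')
    (f : U -> Cplx R) (g : T -> U) :
  cmeasurable f -> measurable_fun setT g -> cmeasurable (fun x => f (g x)).
Proof.
move=> [f1 f2] mg; split.
- exact: (@measurableT_comp _ _ _ _ _ _ (fun x => complex.Re (f x))).
- exact: (@measurableT_comp _ _ _ _ _ _ (fun x => complex.Im (f x))).
Qed.

Local Notation I01 := (`[0, 1]%classic : set R).

(* [phi] is approximated by its values at the points k/n of the segment. *)
Lemma caratheodory_measurable d (T : measurableType d) (phi : R -> T -> R) :
  (forall w (t : R), 0 <= t <= 1 -> phi ^~ w @ t --> phi t w) ->
  (forall t : R, 0 <= t <= 1 -> measurable_fun setT (phi t)) ->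
  measurable_fun setT
    (fun x : measurableTypeR R * T => \1_I01 x.1 * phi x.1 x.2).
Proof.
move=> cphi mphi.
pose J n k : set (measurableTypeR R) :=
  `[k%:R / n.+1%:R, k.+1%:R / n.+1%:R[%classic.
(* The point t = 1 falls in the cell of index n + 1, hence [n.+2] terms; the nodes, being left
   endpoints of the cells, stay in [0, 1]. *)
pose psi n (x : measurableTypeR R * T) := \1_I01 x.1 *
  \sum_(k < n.+2) \1_(J n k) x.1 * phi (k%:R / n.+1%:R) x.2.
have m1 (A : set (measurableTypeR R)) : measurable A -> measurable_fun setT
    (fun x : measurableTypeR R * T => \1_A x.1 : R).
  move=> mA; apply: (@measurableT_comp _ _ _ _ _ _ (\1_A : measurableTypeR R -> R)).
    exact: measurable_indic.
  exact: measurable_fst.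
apply: (@measurable_fun_cvg _ _ R setT psi) => [n|].
  apply: measurable_funM; first by apply: m1; exact: I01_measurable.
  apply: measurable_sum => k; apply: measurable_funM.
    by apply: m1; exact: measurable_itv.
  apply: (@measurableT_comp _ _ _ _ _ _ (phi (k%:R / n.+1%:R))).
    apply: mphi; rewrite divr_ge0//= ler_pdivrMr// mul1r ler_nat.
    by rewrite -ltnS ltn_ord.
  exact: measurable_snd.
move=> [t w] _; rewrite /psi/= indicE; case: (boolP (t \in I01)) => tI; last first.
  by rewrite mul0r; under eq_fun do rewrite mul0r; exact: cvg_cst.
rewrite mul1r; under eq_fun do rewrite mul1r.
have t01 : 0 <= t <= 1 by move: tI; rewrite inE /= in_itv.
pose k n := Num.trunc (t * n.+1%:R).
have kP n : (k n)%:R / n.+1%:R <= t < (k n).+1%:R / n.+1%:R.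
  have := @truncn_itv R (t * n.+1%:R); rewrite mulr_ge0//; last by case/andP: t01.
  by move=> /(_ isT); rewrite ler_pdivrMr// ltr_pdivlMr.
have kn n : (k n < n.+2)%N.
  have /andP[h _] := kP n; case/andP: t01 => t0 t1; rewrite ltnS -(ler_nat R).
  by have := le_trans h t1; rewrite ler_pdivrMr// mul1r.
have -> : (fun n => \sum_(i < n.+2) \1_(J n i) t * phi (i%:R / n.+1%:R) w) =
    (fun n => phi ((k n)%:R / n.+1%:R) w).
  apply/funext => n; rewrite (bigD1 (Ordinal (kn n)))//= big1 ?addr0.
    by rewrite indicE mem_set ?mul1r// /J/= in_itv/=; exact: kP.
  move=> i; rewrite -val_eqE/= => ik; rewrite indicE memNset ?mul0r//.
  rewrite /J/= in_itv/= ler_pdivrMr// ltr_pdivlMr// => h; move/eqP: ik; apply.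
  by rewrite /k (truncn_def h).
apply: (@cvg_comp _ _ _ (fun n => (k n)%:R / n.+1%:R) (phi ^~ w) _ (nbhs t)); last exact: cphi.
apply/cvgrPdist_lt => e e0; have := near_infty_natSinv_lt (PosNum e0).
apply: filterS => n /= h; rewrite ger0_norm ?subr_ge0; last by case/andP: (kP n).
have /andP[_] := kP n; rewrite -natr1 mulrDl mul1r => h2; by rewrite ltrBlDl (lt_trans h2)// ltrD2l.
Qed.

Lemma caratheodory_cmeasurable d (T : measurableType d) (phi : R -> T -> Cplx R) :
  (forall w (t : R), 0 <= t <= 1 -> phi ^~ w @ t --> phi t w) ->
  (forall t : R, 0 <= t <= 1 -> cmeasurable (phi t)) ->
  cmeasurable (fun x : measurableTypeR R * T => (\1_I01 x.1)%:C * phi x.1 x.2).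
Proof.
move=> cphi mphi; split.
- rewrite (_ : (fun x => _) = fun x => \1_I01 x.1 * complex.Re (phi x.1 x.2)).
    apply: (@caratheodory_measurable _ _ (fun t w => complex.Re (phi t w))) => [w t|t] t01.
      apply/cvgrPdist_lt => e e0; have /cvg_rnormP/(_ e e0) := cphi w t t01.
      by apply: filterS => s /= h; rewrite distrC -cReB (le_lt_trans (Re_le_rnorm _)).
    by have [] := mphi t t01.
  by apply/funext => x; rewrite cReM/= mul0r subr0.
- rewrite (_ : (fun x => _) = fun x => \1_I01 x.1 * complex.Im (phi x.1 x.2)).
    apply: (@caratheodory_measurable _ _ (fun t w => complex.Im (phi t w))) => [w t|t] t01.
      apply/cvgrPdist_lt => e e0; have /cvg_rnormP/(_ e e0) := cphi w t t01.
      by apply: filterS => s /= h; rewrite distrC -cImB (le_lt_trans (Im_le_rnorm _)).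
    by have [] := mphi t t01.
  by apply/funext => x; rewrite cImM/= mul0r addr0.
Qed.

End measurability.

(** * Exchange of the integrals over [0, 1] and Omega *)

Section fubini.
Variable R : realType.
Local Open Scope complex_scope.
Local Notation leb := (@lebesgue_measure R).
Local Notation I01 := (`[0, 1]%classic : set R).
Context d (Omega : measurableType d) (mu : {finite_measure set Omega -> \bar R}).

Let sigma_leb : {sigma_finite_measure set (measurableTypeR R) -> \bar R} := leb.
Let sigma_mu : {sigma_finite_measure set Omega -> \bar R} := mu.

(** As [F] vanishes off the segment, the integral over [0, 1] is one over the whole line and
    Fubini's theorem for the product measure applies. Since the segment has length 1, domination by
    a function of [w] alone gives joint integrability. *)
Lemma fubini01 (F : measurableTypeR R * Omega -> R) (phi : Omega -> R) :
  measurable_fun setT F -> mu.-integrable setT (EFin \o phi) ->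
  (forall t w, ~ I01 t -> F (t, w) = 0) ->
  (forall t w, I01 t -> `|F (t, w)| <= phi w) ->
  mu.-integrable setT (fun w => (\int[leb]_(t in I01) F (t, w))%:E) /\
  \int[leb]_(t in I01) \int[mu]_w F (t, w) =
  \int[mu]_w \int[leb]_(t in I01) F (t, w).
Proof.
move=> mF iphi F0 Fphi.
have mI := @I01_measurable R.
have mEF : measurable_fun setT (EFin \o F) by exact/measurable_EFinP.
have phi0 w : 0 <= phi w.
  by rewrite (le_trans (normr_ge0 _) (Fphi 0 w _))//= in_itv/= lexx ler01.
have FI (G : measurableTypeR R -> \bar R) : (forall t, ~ I01 t -> G t = 0%E) ->
    (\int[leb]_t G t = \int[leb]_(t in I01) G t)%E.
  move=> G0; rewrite [RHS]integral_mkcond; apply: eq_integral => t _.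
  rewrite patchE; case: ifPn => // /negP h; apply: G0 => h'; apply: h; exact/mem_set.
have FI_le w : (\int[leb]_(t in I01) `|(F (t, w))%:E| <= (phi w)%:E)%E.
  apply: (@le_trans _ _ (\int[leb]_(t in I01) (phi w)%:E)%E).
    apply: ge0_le_integral => //.
    - apply: measurable_funTS; apply: measurableT_comp => //.
      exact: (measurable_fun_pair1 w mEF).
    - by move=> t It; rewrite lee_fin Fphi.
  rewrite integral_cst// [X in (_ * X)%E](_ : _ = 1%E) ?mule1//.
  by rewrite /= lebesgue_measure_itv/= lte_fin ltr01 oppr0 adde0.
have iF : (sigma_leb \x sigma_mu)%E.-integrable setT (EFin \o F).
  apply/integrable21ltyP => //=.
  apply: (@le_lt_trans _ _ (\int[mu]_w (phi w)%:E)%E); last first.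
    have := integrable_fin_num measurableT iphi; rewrite ge0_fin_numE//.
    by apply: integral_ge0 => w _; rewrite lee_fin.
  apply: ge0_le_integral => //.
  - by move=> w _; exact: integral_ge0.
  - apply: (@measurable_fun_fubini_tonelli_G _ _ _ _ _ sigma_leb (abse \o (EFin \o F))).
      exact: measurableT_comp.
    by move=> x; exact: abse_ge0.
  - by case/integrableP : iphi.
  - move=> w _; rewrite FI; last by move=> t tI; rewrite /= F0// normr0.
    exact: FI_le.
have iFw w : leb.-integrable I01 (fun t => (F (t, w))%:E).
  apply/integrableP; split.
    by apply: measurable_funTS; exact: (measurable_fun_pair1 w mEF).
  by rewrite (le_lt_trans (FI_le w))// ltry.
have iFt t : I01 t -> mu.-integrable setT (fun w => (F (t, w))%:E).
  move=> It; apply: (le_integrable _ _ _ iphi) => //.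
    exact: (measurable_fun_pair2 t mEF).
  by move=> w _; rewrite /= lee_fin (ger0_norm (phi0 w)) Fphi.
have GE w : (\int[leb]_(t in I01) F (t, w))%:E =
    fubini_G sigma_leb (EFin \o F) w.
  rewrite /fubini_G FI; last by move=> t tI; rewrite /= F0.
  by rewrite fineK// integrable_fin_num.
have HE t : I01 t -> (\int[mu]_w F (t, w))%:E = fubini_F sigma_mu (EFin \o F) t.
  by move=> It; rewrite fineK// integrable_fin_num//; exact: iFt.
split.
- under eq_fun do rewrite GE; apply: (le_integrable _ _ _ iphi) => //.
    exact: (measurable_fubini_G iF).
  move=> w _; rewrite /= -GE lee_fin (ger0_norm (phi0 w)).
  rewrite (le_trans (le_normr_Rintegral _ (iFw w)))//.
  rewrite -lee_fin /Rintegral fineK; first exact: FI_le.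
  by apply: (integrable_fin_num mI); exact: integrable_abse (iFw w).
- congr fine; under eq_integral => t /set_mem It do rewrite (HE _ It).
  rewrite -FI; last by move=> t tI; rewrite /fubini_F integral0_eq// => w _; rewrite /= F0.
  under [RHS]eq_integral do rewrite GE.
  exact: (Fubini iF).
Qed.

End fubini.

(** * The kernel that represents T_g composed with P *)

Section kernel_transform.
Variable R : realType.
Local Open Scope complex_scope.
Local Notation leb := (@lebesgue_measure R).
Local Notation I01 := (`[0, 1]%classic : set R).
Context d (Omega : measurableType d) (mu : {finite_measure set Omega -> \bar R}).

Lemma cintegrable_le (f : Omega -> Cplx R) (phi : Omega -> R) :
  cmeasurable f -> mu.-integrable setT (EFin \o phi) ->
  (forall w, rnorm (f w) <= phi w) -> cintegrable mu setT f.
Proof.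
move=> [f1 f2] iphi fphi.
have phi0 w : 0 <= phi w by rewrite (le_trans (rnorm_ge0 _) (fphi w)).
split; apply: (le_integrable measurableT _ _ iphi).
- exact/measurable_EFinP.
- by move=> w _; rewrite lee_fin (ger0_norm (phi0 w)) (le_trans (Re_le_rnorm _)).
- exact/measurable_EFinP.
- by move=> w _; rewrite lee_fin (ger0_norm (phi0 w)) (le_trans (Im_le_rnorm _)).
Qed.

Lemma cfubini01 (F : measurableTypeR R * Omega -> Cplx R) (phi : Omega -> R) :
  cmeasurable F -> mu.-integrable setT (EFin \o phi) ->
  (forall t w, ~ I01 t -> F (t, w) = 0) ->
  (forall t w, I01 t -> rnorm (F (t, w)) <= phi w) ->
  cintegrable mu setT (fun w => cintegral leb I01 (fun t => F (t, w))) /\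
  cintegral leb I01 (fun t => cintegral mu setT (fun w => F (t, w))) =
  cintegral mu setT (fun w => cintegral leb I01 (fun t => F (t, w))).
Proof.
move=> [F1 F2] iphi F0 Fphi.
have [||i1 e1] := fubini01 F1 iphi.
- by move=> t w It; rewrite F0.
- by move=> t w It; rewrite (le_trans (Re_le_rnorm _))// Fphi.
have [||i2 e2] := fubini01 F2 iphi.
- by move=> t w It; rewrite F0.
- by move=> t w It; rewrite (le_trans (Im_le_rnorm _))// Fphi.
by split; [split; [exact: i1|exact: i2]|congr (_ +i* _); [exact: e1|exact: e2]].
Qed.

Variable K : Cplx R -> Omega -> Cplx R.
Hypothesis K_analytic : forall w : Omega, analytic_on_disc (fun z => K z w).
Hypothesis K_measurable : forall z : Cplx R, unit_disc z -> cmeasurable (K z).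
Hypothesis K_bounded : forall E : set (Cplx R), compact E -> E `<=` @unit_disc R ->
  exists B : R, forall (z : Cplx R) (w : Omega), E z -> rnorm (K z w) <= B.

Lemma kernel_segment_bounded z : unit_disc z -> exists B : R, 0 <= B /\
  forall (t : R) w, 0 <= t <= 1 -> rnorm (K (t%:C * z) w) <= B.
Proof.
move=> zD; pose E : set (Cplx R) := (fun t : R => t%:C * z) @` I01.
have cE : compact E.
  apply: continuous_compact; last exact: segment_compact.
  apply: continuous_subspaceT => t; apply: cvg_cmul; last exact: cvg_cst.
  exact: cvg_real_complex.
have ED : E `<=` @unit_disc R.
  by move=> _ [t + <-]; rewrite /= in_itv/=; exact: segment_in_disc.
have [B HB] := K_bounded cE ED; exists (Num.max 0 B).
split=> [|t w t01]; first by rewrite le_max lexx.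
by rewrite le_max HB ?orbT//; exists t => //=; rewrite in_itv.
Qed.

Variable g : Cplx R -> Cplx R.
Hypothesis g_analytic : analytic_on_disc g.

(** This is k_z: integration against it gives the functional h |-> T_g(P h)(z) on L^p. *)
Definition transform z w :=
  segment_integral (fun zeta => derive1 g zeta * K zeta w) z.

(** The integrand is continuous in [t], measurable in [w] and bounded on the segment, hence jointly
    measurable and dominated by a multiple of |h|. One application of Fubini's theorem for general
    [h] serves both the measurability and the representation. *)
Lemma transformP z : unit_disc z ->
  [/\ cmeasurable (transform z),
      exists B : R, forall w, rnorm (transform z w) <= B &
      forall h : Omega -> Cplx R, cmeasurable h ->
        mu.-integrable setT (fun w => (rnorm (h w))%:E) ->
        forall f : Cplx R -> Cplx R,
        (forall u, unit_disc u -> f u = cintegral mu setT (fun w => h w * K u w)) ->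
        T_op g f z = cintegral mu setT (fun w => h w * transform z w)].
Proof.
move=> zD; have sD (t : R) : 0 <= t <= 1 -> unit_disc (t%:C * z).
  exact: segment_in_disc.
have g'a : analytic_on_disc (derive1 g) by move=> u /g_analytic/analytic_derive1.
have [B1 HB1] := segment_bounded g'a zD.
have B10 : 0 <= B1 by rewrite (le_trans (rnorm_ge0 _) (HB1 0 _))// lexx ler01.
have [B2 [B20 HB2]] := kernel_segment_bounded zD.
pose Psi (t : R) w := derive1 g (t%:C * z) * K (t%:C * z) w.
have cPsi w (t : R) : 0 <= t <= 1 -> Psi ^~ w @ t --> Psi t w.
  move=> t01; apply: cvg_cmul.
    exact/cvg_segment/g'a/sD.
  exact: (@cvg_segment _ (fun u => K u w) z t (K_analytic w (sD t t01))).
have PsiB t w : 0 <= t <= 1 -> rnorm (Psi t w) <= B1 * B2.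
  by move=> t01; rewrite rnormM ler_pM ?rnorm_ge0 ?HB1 ?HB2.
have mPsi (t : R) : 0 <= t <= 1 -> cmeasurable (Psi t).
  move=> t01; apply: cmeasurableM; first exact: cmeasurable_cst.
  by apply: K_measurable; exact: sD.
have kE w : transform z w = z * cintegral leb I01 (Psi ^~ w) by [].
have mJ := caratheodory_cmeasurable cPsi mPsi.
have iPsi w := cintegrable01 (cPsi w).
have transform_fubini h : cmeasurable h ->
    mu.-integrable setT (fun w => (rnorm (h w))%:E) ->
    cintegrable mu setT (fun w => h w * cintegral leb I01 (Psi ^~ w)) /\
    cintegral leb I01 (fun t => cintegral mu setT (fun w => h w * Psi t w)) =
    cintegral mu setT (fun w => h w * cintegral leb I01 (Psi ^~ w)).
  move=> mh ih.
  pose F (x : measurableTypeR R * Omega) := h x.2 * ((\1_I01 x.1)%:C * Psi x.1 x.2).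
  have FE t w : I01 t -> F (t, w) = h w * Psi t w.
    by move=> It; rewrite /F/= indicE mem_set// mul1r.
  have F0 t w : ~ I01 t -> F (t, w) = 0.
    by move=> It; rewrite /F/= indicE memNset// mul0r mulr0.
  have mF : cmeasurable F.
    apply: cmeasurableM mJ; apply: cmeasurable_comp mh _; exact: measurable_snd.
  have iphi : mu.-integrable setT (EFin \o (fun w => B1 * B2 * rnorm (h w))).
    exact: (integrableZl measurableT (B1 * B2) ih).
  have [|i1 e1] := cfubini01 mF iphi F0.
    move=> t w It; rewrite FE// rnormM mulrC ler_wpM2r ?rnorm_ge0//.
    by apply: PsiB; move: It; rewrite /= in_itv.
  have hE w : cintegral leb I01 (fun t => F (t, w)) =
      h w * cintegral leb I01 (Psi ^~ w).
    rewrite -(cintegralZ (@I01_measurable R) _ (iPsi w)).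
    by apply: eq_cintegral => t It; exact: FE.
  split; first by move: i1; under eq_fun do rewrite hE.
  transitivity (cintegral leb I01 (fun t => cintegral mu setT (fun w => F (t, w)))).
    by apply: eq_cintegral => t It; apply: eq_cintegral => w _; rewrite FE.
  by rewrite e1; apply: eq_cintegral => w _; rewrite hE.
split.
(* For the constant 1, integrable because [mu] is finite, the integrability part of Fubini contains
   the measurability of the kernel in [w]. *)
- have [||[i1 i2] _] := transform_fubini (fun=> 1).
  + exact: cmeasurable_cst.
  + by under eq_fun do rewrite rnorm1; exact: finite_measure_integrable_cst.
  + have mJ' : cmeasurable (fun w => 1 * cintegral leb I01 (Psi ^~ w)).
      by split; [case/integrableP : i1 => /measurable_EFinP|
                 case/integrableP : i2 => /measurable_EFinP].
    have := cmeasurableM (cmeasurable_cst _ z) mJ'.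
    by under eq_fun do rewrite mul1r -kE.
- exists (2 * (B1 * B2)) => w; rewrite kE rnormM.
  have h1 := cintegral01_le (cPsi w) (PsiB ^~ w).
  rewrite (le_trans (ler_wpM2l (rnorm_ge0 _) h1))//.
  rewrite ler_piMl ?mulr_ge0//; apply: ltW; exact/unit_discE.
- move=> h mh ih f fE; have [i1 e1] := transform_fubini h mh ih.
  have -> : T_op g f z = z * cintegral leb I01
      (fun t => cintegral mu setT (fun w => h w * Psi t w)).
    rewrite /T_op /segment_integral; congr (_ * _); apply: eq_cintegral => t.
    rewrite /= in_itv/= => t01; rewrite fE; last exact: sD.
    rewrite mulrC -cintegralZ//; last first.
      apply: (@cintegrable_le _ (fun w => B2 * rnorm (h w))).
      - by apply: cmeasurableM => //; exact/K_measurable/sD.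
      - exact: (integrableZl measurableT B2 ih).
      - by move=> w; rewrite rnormM mulrC ler_wpM2r ?rnorm_ge0 ?HB2.
    by apply: eq_cintegral => w _; rewrite /Psi; ring.
  rewrite e1 -cintegralZ//; apply: eq_cintegral => w _.
  by rewrite kE; ring.
Qed.

End kernel_transform.

(** * Lebesgue spaces *)

(** Differentiability of the power gives continuity at x > 0 only; at 0 the bound s n < e^(1/r) is
    raised to the power r. *)
Lemma cvg_powR (R : realType) (s : nat -> R) (x r : R) : 0 < r ->
  (forall n, 0 <= s n) -> 0 <= x -> s @ \oo --> x ->
  (fun n => s n `^ r) @ \oo --> x `^ r.
Proof.
move=> r0 s0; rewrite le_eqVlt => /predU1P[<-|x0] sx; last first.
  have /derivable1_diffP/differentiable_continuous cx : derivable (@powR R ^~ r) x 1.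
    by apply: derivable_powR; rewrite in_itv/= x0.
  exact: (cvg_comp _ _ sx cx).
rewrite powR0 ?gt_eqF//; apply/cvgrPdist_lt => e e0.
have er : 0 < e `^ r^-1 by rewrite powR_gt0.
move/cvgrPdist_lt : sx => /(_ _ er); apply: filterS => n.
rewrite !sub0r !normrN !ger0_norm ?powR_ge0// => h.
have := gt0_ltr_powR r0 _ _ h; rewrite !nnegrE s0 powR_ge0 => /(_ isT isT).
by rewrite -powRrM mulVf ?gt_eqF// powRr1// ltW.
Qed.

Section Lnorm_theory.
Context (R : realType) d (T : measurableType d) (mu : {finite_measure set T -> \bar R}).
Implicit Types (f g u v : T -> R) (p : \bar R).
Local Open Scope ereal_scope.
Local Notation "''NR_' p ( f )" := (Lnorm mu p (EFin \o f)) (at level 5, p at level 9, f at level 99).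

Lemma mu0_ae (P : T -> Prop) : ~~ (0 < mu setT) -> \forall x \ae mu, P x.
Proof.
rewrite -leNgt => mu0; exists setT; split => //.
by apply/eqP; rewrite eq_le mu0 measure_ge0.
Qed.

(** When the whole space is null, the norm has the default value 0 and every property holds almost
    everywhere, so the equivalence survives. *)
Lemma Lnormy_le f (c : R) : (0 <= c)%R ->
  'NR_+oo(f) <= c%:E <-> \forall x \ae mu, (`|f x| <= c)%R.
Proof.
move=> c0; rewrite unlock; case: ifPn => mu0.
  by split=> [/ess_supP|h]; [|apply/ess_supP; move: h]; apply: filterS => x /=;
    rewrite lee_fin.
by split=> // _; exact: mu0_ae.
Qed.

Lemma LnormrE f (r : R) : 'NR_r%:E(f) = (\int[mu]_x (`|f x| `^ r)%:E) `^ r^-1.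
Proof.
by rewrite unlock.
Qed.

Lemma measurable_norm_powR f r : measurable_fun setT f ->
  measurable_fun setT (fun x => (`|f x| `^ r)%:E).
Proof.
move=> mf; apply/measurable_EFinP.
apply: (measurableT_comp (@measurable_powR R r)).
exact: measurableT_comp.
Qed.

Lemma Lnorm_le_ae f g p : 1 <= p -> measurable_fun setT f -> measurable_fun setT g ->
  (\forall x \ae mu, (`|f x| <= `|g x|)%R) -> 'NR_p(f) <= 'NR_p(g).
Proof.
case: p => [r| |]//= p1 mf mg fg.
  have r0 : (0 < r)%R by rewrite -lte_fin (lt_le_trans _ p1)// lte_fin.
  rewrite !LnormrE gt0_ler_poweR ?invr_ge0 ?(ltW r0)//.
  - by rewrite in_itv/= leey andbT integral_ge0.
  - by rewrite in_itv/= leey andbT integral_ge0.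
  apply: ae_ge0_le_integral => //.
  - exact: measurable_norm_powR.
  - exact: measurable_norm_powR.
  apply: filterS fg => x fgx _; by rewrite lee_fin (ge0_ler_powR (ltW r0)) ?nnegrE.
have := Lnorm_ge0 mu +oo (EFin \o g); case E : ('NR_+oo(g)) => [c| |]//; last first.
  by move=> _; rewrite leey.
rewrite lee_fin => c0; apply/Lnormy_le => //.
have /(Lnormy_le _ c0) : 'NR_+oo(g) <= c%:E by rewrite E.
by apply: filterS2 fg => x; exact: le_trans.
Qed.

(** For finite p this is Fatou's lemma applied to the p-th powers; for p = +oo the countably many
    exceptional null sets are discarded together. It passes bounds on partial sums to the sum of a
    series. *)
Lemma fatou_Lnorm (f_ : nat -> T -> R) f p (c : R) : 1 <= p ->
  (forall n, measurable_fun setT (f_ n)) -> measurable_fun setT f ->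
  (forall x, f_ ^~ x @ \oo --> f x) -> (forall n, 'NR_p(f_ n) <= c%:E) ->
  'NR_p(f) <= c%:E.
Proof.
move=> p1 mf_ mf f_f f_c.
have c0 : (0 <= c)%R by rewrite -lee_fin (le_trans (Lnorm_ge0 _ _ _) (f_c 0%N)).
case: p p1 f_c => [r| |]//= p1 f_c; last first.
  apply/Lnormy_le => //.
  have := ae_foralln (fun n => (Lnormy_le (f_ n) c0).1 (f_c n)).
  apply: filterS => x fx; apply/ler_addgt0Pr => e e0.
  have /cvgrPdist_lt/(_ e e0)[N _ HN] := f_f x.
  have := HN N (leqnn N) => /= h.
  rewrite -(subrK (f_ N x) (f x)) (le_trans (ler_normD _ _))// addrC lerD//.
  exact: ltW.
have r0 : (0 < r)%R by rewrite -lte_fin (lt_le_trans _ p1)// lte_fin.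
have cr0 : 0 <= (c `^ r)%:E by rewrite lee_fin powR_ge0.
have Hn n : \int[mu]_x (`|f_ n x| `^ r)%:E <= (c `^ r)%:E.
  have := f_c n; rewrite LnormrE => h.
  have := @gt0_ler_poweR R r (ltW r0) _ c%:E _ _ h.
  rewrite -poweRrM mulVf ?gt_eqF// poweRe1 ?integral_ge0// poweR_EFin; apply.
  - by rewrite in_itv/= leey poweR_ge0.
  - by rewrite in_itv/= lee_fin c0 leey.
suff : \int[mu]_x (`|f x| `^ r)%:E <= (c `^ r)%:E.
  move=> h; rewrite LnormrE.
  have -> : c%:E = (c `^ r)%:E `^ r^-1.
    by rewrite poweR_EFin -powRrM mulfV ?gt_eqF// powRr1.
  rewrite gt0_ler_poweR ?invr_ge0 ?(ltW r0)//.
  - by rewrite in_itv/= leey andbT integral_ge0.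
  - by rewrite in_itv/= cr0 leey.
have h x : limn_einf (fun n => (`|f_ n x| `^ r)%:E) = (`|f x| `^ r)%:E.
  have fr : (fun n => (`|f_ n x| `^ r)%:E) @ \oo --> (`|f x| `^ r)%:E.
    apply: cvg_EFin; first exact: nearW.
    by apply: cvg_powR => //; apply: cvg_norm; exact: f_f.
  by rewrite (cvg_limn_einf_sup fr).1.
under eq_integral do rewrite -h.
apply: (@le_trans _ _ (limn_einf (fun n => \int[mu]_x (`|f_ n x| `^ r)%:E))).
  by apply: fatou => // n; exact: measurable_norm_powR.
rewrite limn_einf_lim; apply: lime_le; first exact: is_cvg_einfs.
apply: nearW => n; rewrite (le_trans _ (Hn n))//.
by apply: ereal_inf_lbound; exists n => /=.
Qed.

End Lnorm_theory.

Section Lp.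
Context (R : realType) d (T : measurableType d) (mu : {finite_measure set T -> \bar R}).
Local Open Scope complex_scope.
Local Open Scope ereal_scope.
Local Notation "''NR_' p ( f )" := (Lnorm mu p (EFin \o f)) (at level 5, p at level 9, f at level 99).

Lemma conjugate_cases (p : \bar R) (q : R) : 1 < p -> hoelder_conjugate p = q%:E ->
  (p = +oo /\ q = 1%R) \/
  exists r : R, [/\ p = r%:E, (1 < r)%R, (1 <= q)%R & (r^-1 + q^-1 = 1)%R].
Proof.
case: p => [r| |]//=; last by rewrite hoelder_conjugatey => _ [<-]; left.
rewrite lte_fin => r1 rq; right; exists r.
have r0 : (0 < r)%R := lt_trans ltr01 r1.
have q1 : (1 <= q)%R.
  by rewrite -lee_fin -rq hoelder_conj_ge1// lee_fin ltW.
have rn0 : r != 0%R by rewrite gt_eqF.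
have qn0 : q != 0%R by rewrite gt_eqF// (lt_le_trans ltr01).
have := @hoelder_conjugate_eq1 R r%:E; rewrite rq ltNyr eqe rn0 => /(_ isT isT).
by rewrite !inver (negbTE rn0) (negbTE qn0) => -[].
Qed.

Lemma conjugate_ge1 (p : \bar R) (q : R) : 1 < p -> hoelder_conjugate p = q%:E -> (1 <= q)%R.
Proof. by move=> p1 /(conjugate_cases p1)[[_ ->]//|[r []]]. Qed.

Lemma hoelder_conjugates (f g : T -> R) (p : \bar R) (q : R) :
  1 < p -> hoelder_conjugate p = q%:E ->
  measurable_fun setT f -> measurable_fun setT g -> 'NR_p(f) < +oo ->
  \int[mu]_x (`|f x * g x|)%:E <= 'NR_p(f) * 'NR_q%:E(g).
Proof.
move=> p1 pq mf mg; have [[-> ->]|[r [-> r1 q1 rq]] _] := conjugate_cases p1 pq; last first.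
  rewrite -(@Lnorm1 _ _ _ mu (EFin \o (f \* g)%R)).
  by apply: hoelder => //; rewrite (lt_le_trans ltr01)// ltW.
have := Lnorm_ge0 mu +oo (EFin \o f); case E : ('NR_+oo(f)) => [c| |]//.
rewrite lee_fin => c0 _.
have fc : \forall x \ae mu, (`|f x| <= c)%R by apply/Lnormy_le => //; rewrite E.
rewrite (Lnorm1 mu (EFin \o g)) /= -ge0_integralZl//; last first.
  by apply/measurable_EFinP; exact: measurableT_comp.
apply: ae_ge0_le_integral => //.
- apply/measurable_EFinP.
  apply: (@measurableT_comp _ _ _ _ _ _ (@Num.norm R R) setT (f \* g)%R) => //.
  exact: measurable_funM.
- by move=> x _; rewrite -EFinM lee_fin mulr_ge0.
- apply/measurable_EFinP; apply: measurable_funM => //; exact: measurableT_comp.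
- by apply: filterS fc => x fx _; rewrite -EFinM lee_fin normrM ler_wpM2r.
Qed.

(** Hoelder's inequality against the constant 1, whose norm is finite because [mu] is: L^p embeds
    continuously in L^1. *)
Lemma integral_le_Lnorm (p : \bar R) (q : R) : 1 < p -> hoelder_conjugate p = q%:E ->
  exists C : R, (0 <= C)%R /\ forall f : T -> R, measurable_fun setT f ->
    'NR_p(f) < +oo -> \int[mu]_x (`|f x|)%:E <= C%:E * 'NR_p(f).
Proof.
move=> p1 pq; have q1 := conjugate_ge1 p1 pq.
have fin : 'NR_q%:E(cst 1%R) \is a fin_num.
  rewrite (@Lnorm_cst1 _ _ _ mu q) fin_num_poweR// fin_num_measure//.
exists (fine 'NR_q%:E(cst 1%R)); split; first exact/fine_ge0/Lnorm_ge0.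
have m1 : measurable_fun [set: T] (cst (1 : R)%R) by exact: measurable_cst.
move=> f mf fp; have := hoelder_conjugates p1 pq mf m1 fp.
by rewrite fineK// muleC; under eq_integral do rewrite mulr1.
Qed.

Implicit Types (f g h : T -> Cplx R) (p : \bar R).

Lemma cLnorm_ge0 p h : 0 <= cLnorm mu p h.
Proof. exact: Lnorm_ge0. Qed.

Lemma cLnorm_le p f g : 1 <= p -> cmeasurable f -> cmeasurable g ->
  (\forall x \ae mu, (rnorm (f x) <= rnorm (g x))%R) -> cLnorm mu p f <= cLnorm mu p g.
Proof.
move=> p1 mf mg fg; apply: Lnorm_le_ae => //; try exact: measurable_rnorm.
by apply: filterS fg => x; rewrite !ger0_norm ?rnorm_ge0.
Qed.

Lemma cLnormD p f g : 1 <= p -> cmeasurable f -> cmeasurable g ->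
  cLnorm mu p (fun x => f x + g x)%R <= cLnorm mu p f + cLnorm mu p g.
Proof.
move=> p1 mf mg.
have [mf' mg'] := (measurable_rnorm mf, measurable_rnorm mg).
apply: le_trans (eminkowski mu mf' mg' p1).
apply: (@Lnorm_le_ae _ _ _ mu (fun x => rnorm (f x + g x)%R)) => //.
- by apply: measurable_rnorm; exact: cmeasurableD.
- exact: measurable_funD.
- by apply/nearW => x /=; rewrite !ger0_norm ?addr_ge0 ?rnorm_ge0 ?ler_rnormD.
Qed.

Lemma cLnormZ p (c : Cplx R) h : 1 <= p -> in_cLp mu p h ->
  cLnorm mu p (fun x => c * h x)%R = (rnorm c)%:E * cLnorm mu p h.
Proof.
move=> p1 [mh hp].
have hL : (fun x => rnorm (h x)) \in Lfun mu p.
  by rewrite inE; apply/andP; split; rewrite inE//=; exact: measurable_rnorm.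
have := @LnormZ _ _ _ mu p p1 (Lfun_Sub p1 hL) (rnorm c).
rewrite ger0_norm ?rnorm_ge0//= => <-; apply: eq_Lnorm => x /=.
by rewrite rnormM.
Qed.

Lemma in_cLpD p f g : 1 <= p -> in_cLp mu p f -> in_cLp mu p g ->
  in_cLp mu p (fun x => f x + g x)%R.
Proof.
move=> p1 [mf fp] [mg gp]; split; first exact: cmeasurableD.
by rewrite (le_lt_trans (cLnormD p1 mf mg))// lte_add_pinfty.
Qed.

Lemma in_cLpZ p (c : Cplx R) h : 1 <= p -> in_cLp mu p h ->
  in_cLp mu p (fun x => c * h x)%R.
Proof.
move=> p1 [mh hp]; split; first by apply: cmeasurableM => //; exact: cmeasurable_cst.
by rewrite cLnormZ// lte_mul_pinfty ?lee_fin ?rnorm_ge0.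
Qed.

Lemma in_cLp0 p : 1 <= p -> in_cLp mu p (fun=> 0%R).
Proof.
move=> p1; split; first exact: cmeasurable_cst.
rewrite /cLnorm; under eq_Lnorm do rewrite rnorm0.
rewrite (@Lnorm0 _ _ _ mu) ?ltry//.
by rewrite gt_eqF// (lt_le_trans _ p1).
Qed.

End Lp.

(** * Completeness of L^p for geometrically decreasing series *)

Section Lp_complete.
Context (R : realType) d (T : measurableType d) (mu : {finite_measure set T -> \bar R}).
Local Open Scope complex_scope.
Local Open Scope ereal_scope.
Implicit Types (f g h : T -> Cplx R) (p : \bar R).

Lemma cmeasurable_sum (h_ : nat -> T -> Cplx R) (s : seq nat) :
  (forall n, cmeasurable (h_ n)) -> cmeasurable (fun x => \sum_(i <- s) h_ i x)%R.
Proof.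
move=> mh; elim: s => [|i s ih].
  by under eq_fun do rewrite big_nil; exact: cmeasurable_cst.
by under eq_fun do rewrite big_cons; exact: cmeasurableD.
Qed.

Lemma cLnorm_sum p (h_ : nat -> T -> Cplx R) (s : seq nat) : 1 <= p ->
  (forall n, cmeasurable (h_ n)) ->
  cLnorm mu p (fun x => \sum_(i <- s) h_ i x)%R <= \sum_(i <- s) cLnorm mu p (h_ i).
Proof.
move=> p1 mh; elim: s => [|i s ih].
  rewrite big_nil /cLnorm; under eq_Lnorm do rewrite big_nil rnorm0.
  by rewrite (@Lnorm0 _ _ _ mu)// gt_eqF// (lt_le_trans _ p1).
rewrite big_cons (_ : (fun x => _) = fun x => h_ i x + \sum_(i <- s) h_ i x)%R.
  rewrite (le_trans (cLnormD mu p1 (mh i) (cmeasurable_sum s mh)))//.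
  exact: leeD.
by apply/funext => x; rewrite big_cons.
Qed.

Lemma cmeasurable_cvg (h_ : nat -> T -> Cplx R) h :
  (forall n, cmeasurable (h_ n)) -> (forall x, h_ ^~ x @ \oo --> h x) ->
  cmeasurable h.
Proof.
move=> mh hc; split.
- apply: (@measurable_fun_cvg _ _ R setT (fun n x => complex.Re (h_ n x))) => [n|x _].
    by have [] := mh n.
  apply/cvgrPdist_lt => e e0; have /cvg_rnormP/(_ e e0) := hc x.
  by apply: filterS => n /= H; rewrite distrC -cReB (le_lt_trans (Re_le_rnorm _)).
- apply: (@measurable_fun_cvg _ _ R setT (fun n x => complex.Im (h_ n x))) => [n|x _].
    by have [] := mh n.
  apply/cvgrPdist_lt => e e0; have /cvg_rnormP/(_ e e0) := hc x.
  by apply: filterS => n /= H; rewrite distrC -cImB (le_lt_trans (Im_le_rnorm _)).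
Qed.

(** By the embedding in L^1 the integrals of the moduli are summable, so the sum of the moduli has a
    finite integral. *)
Lemma ae_summable (p : \bar R) (q C : R) (h_ : nat -> T -> Cplx R) :
  1 < p -> hoelder_conjugate p = q%:E ->
  (forall n, cmeasurable (h_ n)) ->
  (forall n, cLnorm mu p (h_ n) <= (C / 2 ^+ n)%:E) ->
  \forall x \ae mu, \sum_(0 <= n <oo) (rnorm (h_ n x))%:E < +oo.
Proof.
move=> p1 pq mh hC; have [D [D0 HD]] := integral_le_Lnorm mu p1 pq.
have C0 : (0 <= C)%R.
  by have := le_trans (cLnorm_ge0 mu p (h_ 0%N)) (hC 0%N); rewrite lee_fin expr0 divr1.
have mr n : measurable_fun setT (fun x => (rnorm (h_ n x))%:E).
  by apply/measurable_EFinP; exact: measurable_rnorm.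
have ge0 n x : 0 <= (rnorm (h_ n x))%:E by rewrite lee_fin rnorm_ge0.
have intn n : \int[mu]_x (rnorm (h_ n x))%:E <= (D * C / 2 ^+ n)%:E.
  have hn : cLnorm mu p (h_ n) < +oo by rewrite (le_lt_trans (hC n))// ltry.
  have := HD (fun x => rnorm (h_ n x)) (measurable_rnorm (mh n)) hn.
  under eq_integral do rewrite ger0_norm ?rnorm_ge0//.
  move=> h1; rewrite (le_trans h1)// -mulrA EFinM lee_wpmul2l ?lee_fin ?hC//.
have sfin : \int[mu]_x (\sum_(0 <= n <oo) (rnorm (h_ n x))%:E) <= (2 * (D * C))%:E.
  rewrite integral_nneseries//; apply: lime_le.
    by apply: is_cvg_nneseries => i _ _; exact: integral_ge0.
  apply: nearW => m; rewrite (le_trans (lee_sum _ (fun i _ => intn i)))//.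
  by rewrite sumEFin lee_fin half_series_le// mulr_ge0.
have si : mu.-integrable setT (fun x => \sum_(0 <= n <oo) (rnorm (h_ n x))%:E).
  apply/integrableP; split; first exact: ge0_emeasurable_sum.
  under eq_integral do rewrite gee0_abs ?nneseries_ge0//.
  by rewrite (le_lt_trans sfin)// ltry.
have := integrable_ae measurableT si; apply: filterS => x /(_ I).
by rewrite ge0_fin_numE// nneseries_ge0.
Qed.

(** The explicit rate serves twice in [open_mapping]: N = 0 bounds the norm of the solution, large N
    identifies its image under [P]. *)
Lemma cLp_series (p : \bar R) (q C : R) (h_ : nat -> T -> Cplx R) :
  1 < p -> hoelder_conjugate p = q%:E ->
  (forall n, cmeasurable (h_ n)) ->
  (forall n, cLnorm mu p (h_ n) <= (C / 2 ^+ n)%:E) ->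
  exists h, in_cLp mu p h /\ forall N,
    cLnorm mu p (fun x => h x - \sum_(0 <= n < N) h_ n x)%R <= (2 * C / 2 ^+ N)%:E.
Proof.
move=> p1 pq mh hC; have := ae_summable p1 pq mh hC; have p1' := ltW p1.
have C0 : (0 <= C)%R.
  by have := le_trans (cLnorm_ge0 mu p (h_ 0%N)) (hC 0%N); rewrite lee_fin expr0 divr1.
set s := fun x => \sum_(0 <= n <oo) (rnorm (h_ n x))%:E => sae.
pose A : set T := [set x | s x < +oo].
have ms : measurable_fun setT s.
  apply: ge0_emeasurable_sum => [n x _ _|n _]; first by rewrite lee_fin rnorm_ge0.
  by apply/measurable_EFinP; exact: measurable_rnorm.
have mA : measurable A by rewrite -[A]setTI; exact: emeasurable_fun_infty_o.
(* The terms are cut off on the null set where the moduli are not summable; the series then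
   converges at every point and its sum is measurable as a pointwise limit. *)
pose k_ n x : Cplx R := ((\1_A x)%:C * h_ n x)%R.
have mk n : cmeasurable (k_ n).
  by apply: cmeasurableM => //; apply: cmeasurable_real; exact: measurable_indic.
have kh n x : (rnorm (k_ n x) <= rnorm (h_ n x))%R.
  rewrite /k_ rnormM rnorm_real indicE; case: (_ \in _); rewrite /= ?normr1 ?mul1r//.
  by rewrite normr0 mul0r rnorm_ge0.
have kC n : cLnorm mu p (k_ n) <= (C / 2 ^+ n)%:E.
  by rewrite (le_trans _ (hC n))//; apply: cLnorm_le => //; apply: nearW => x.
have /choice[h hP] : forall x, exists l : Cplx R, series (k_ ^~ x) @ \oo --> l.
  move=> x; have [Ax|nAx] := pselect (A x).
    apply: (@cvg_series_rnorm_bounded _ (fine (s x))) => n.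
    rewrite -lee_fin fineK; last first.
      by rewrite ge0_fin_numE// nneseries_ge0// => *; rewrite lee_fin rnorm_ge0.
    rewrite -sumEFin; apply: (@le_trans _ _ (\sum_(0 <= i < n) (rnorm (h_ i x))%:E)).
      by apply: lee_sum => i _; rewrite lee_fin.
    by apply: nneseries_lim_ge => *; rewrite lee_fin rnorm_ge0.
  apply: (@cvg_series_rnorm_bounded _ 0) => n; rewrite big1// => i _.
  by rewrite /k_ indicE memNset// mul0r rnorm0.
have mh' : cmeasurable h.
  apply: (cmeasurable_cvg _ hP) => n; exact: cmeasurable_sum.
have tail N : cLnorm mu p (fun x => h x - \sum_(0 <= n < N) k_ n x)%R
    <= (2 * C / 2 ^+ N)%:E.
  have m1 M : cmeasurable (fun x => \sum_(N <= n < N + M) k_ n x)%R.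
    exact: cmeasurable_sum.
  have m2 : cmeasurable (fun x => h x - \sum_(0 <= n < N) k_ n x)%R.
    by apply: cmeasurableB => //; exact: cmeasurable_sum.
  (* The tail is the limit in M of the sums over N <= n < N + M, whose norms are at most 2 C / 2^N
     by the triangle inequality. *)
  apply: (@fatou_Lnorm _ _ _ mu
    (fun M x => rnorm (\sum_(N <= n < N + M) k_ n x)%R) _ p) => //.
  - by move=> M; exact: measurable_rnorm.
  - exact: measurable_rnorm.
  - move=> x; have /cvg_rnormP hx := hP x; apply/cvgrPdist_lt => e e0.
    have [N0 _ HN0] := hx e e0; exists N0 => // M /= N0M.
    have := HN0 (N + M)%N (leq_trans N0M (leq_addl _ _)) => /=.
    have -> : series (k_ ^~ x) (N + M)%N =
        (\sum_(0 <= n < N) k_ n x + \sum_(N <= n < N + M) k_ n x)%R.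
      by rewrite /series/= (@big_cat_nat _ _ _ N)//= leq_addr.
    apply: le_lt_trans; rewrite (le_trans (ler_rnorm_dist _ _))//.
    by rewrite [leRHS]rdistC opprD addrA.
  - move=> M; rewrite (le_trans (cLnorm_sum _ p1' mk))//.
    rewrite -{1}[N]add0n big_addn addKn.
    apply: (@le_trans _ _ (\sum_(0 <= i < M) (C / 2 ^+ N / 2 ^+ i)%:E)).
      by apply: lee_sum => i _; rewrite (le_trans (kC _))// exprD invfM mulrA mulrAC.
    rewrite sumEFin lee_fin -mulrA half_series_le// divr_ge0// exprn_ge0//.
exists h; split.
  split => //; have := tail 0%N; under [cLnorm mu p _]eq_Lnorm do rewrite big_geq// subr0.
  by move=> /le_lt_trans; apply; rewrite ltry.
move=> N; rewrite (le_trans _ (tail N))//; apply: cLnorm_le => //.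
- by apply: cmeasurableB => //; exact: cmeasurable_sum.
- by apply: cmeasurableB => //; exact: cmeasurable_sum.
apply: filterS sae => x Ax; rewrite le_eqVlt; apply/orP; left; apply/eqP.
congr (rnorm (_ - _)%R); apply: eq_bigr => n _; rewrite /k_ indicE mem_set//.
by rewrite mul1r.
Qed.

End Lp_complete.

(** * The open mapping theorem on L^p *)

Section open_mapping.
Context (R : realType) (X : completeNormedModType R[i]).
Local Open Scope complex_scope.

(* Baire's theorem in the library is for real scalars only. *)
Lemma baire_cover (A : nat -> set X) : (forall x, exists n, A n x) ->
  exists (n : nat) (x : X) (r : R), 0 < r /\
    forall y, rnorm (y - x) < r -> forall e : R, 0 < e ->
    exists2 a, A n a & rnorm (a - y) < e.
Proof.
move=> Acov; apply: contrapT => nA.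
(* A pair stands for a ball, center and radius. If [A n] is dense in no ball, every ball contains
   one of at most half its radius that [A n] avoids even after its radius is doubled. *)
have step (v : nat * (X * R)) : exists w : X * R, 0 < v.2.2 ->
    [/\ 0 < w.2, w.2 <= v.2.2 / 2, rnorm (w.1 - v.2.1) < v.2.2 / 2 &
        forall a, A v.1 a -> 2 * w.2 <= rnorm (a - w.1)].
  case: v => n [x r] /=; have [r0|] := ltP 0 r; last by exists (x, r).
  apply: contrapT => nw; apply: nA; exists n, x, (r / 2).
  split=> [|y yr e e0]; first by lra.
  apply: contrapT => na; apply: nw; exists (y, Num.min (e / 2) (r / 2)) => _ /=.
  split => //.
  - by rewrite lt_min; apply/andP; split; lra.
  - by rewrite ge_min lexx orbT.
  - move=> a Aa; rewrite leNgt; apply/negP => ae; apply: na; exists a => //.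
    rewrite (lt_le_trans ae)//.
    have : Num.min (e / 2) (r / 2) <= e / 2 by rewrite ge_min lexx.
    lra.
have [f fP] := choice step.
pose v := fix v n : X * R := if n is m.+1 then f (m, v m) else (0, 1).
have v0 n : 0 < (v n).2.
  by elim: n => [|n ih] /=; [exact: ltr01|have [] := fP (n, v n) ih].
have vP n : [/\ (v n.+1).2 <= (v n).2 / 2, rnorm ((v n.+1).1 - (v n).1) < (v n).2 / 2 &
    forall a, A n a -> 2 * (v n.+1).2 <= rnorm (a - (v n.+1).1)].
  by have [] := fP (n, v n) (v0 n).
have nest n k : rnorm ((v (n + k)%N).1 - (v n).1) + (v (n + k)%N).2 <= (v n).2.
  elim: k => [|k ih]; first by rewrite addn0 subrr rnorm0 add0r.
  rewrite addnS; have [h1 h2 _] := vP (n + k)%N.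
  have := ler_rdistD (v (n + k)%N).1 (v (n + k).+1).1 (v n).1.
  lra.
have vhalf n : (v n).2 <= 1 / 2 ^+ n.
  elim: n => [|n ih]; first by rewrite /= expr0 divr1.
  have [h _ _] := vP n; rewrite (le_trans h)// exprSr invfM mulrA ler_wpM2r//.
have near_v n m : (n <= m)%N -> rnorm ((v m).1 - (v n).1) <= (v n).2.
  by move=> nm; have := nest n (m - n)%N; rewrite subnKC//; have := v0 m; lra.
have [l vl] : exists l : X, (fun n => (v n).1) @ \oo --> l.
  apply: cauchy_rnorm_cvg => e e0.
  have : (fun N => 1 * (2^-1) ^+ N) @ \oo --> (0 : R).
    by apply: cvg_geometric; rewrite ger0_norm; lra.
  move=> /cvgrPdist_lt/(_ e e0)[N _ /(_ N (leqnn N))] /=.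
  rewrite sub0r normrN => h; exists N => n Nn.
  rewrite (le_lt_trans (near_v _ _ Nn))// (le_lt_trans (vhalf N))//.
  by rewrite -exprVn (le_lt_trans (ler_norm _) h).
have lv n : rnorm (l - (v n).1) <= (v n).2.
  have h : (fun m => (v m).1 - (v n).1) @ \oo --> l - (v n).1.
    apply/cvg_rnormP => e e0; move/cvg_rnormP : vl => /(_ e e0).
    by apply: filterS => m; rewrite opprB addrA subrK.
  apply: (rnorm_lim_le h).
  by exists n => // m /=; exact: near_v.
(* The limit is within the radius of the center of ball n.+1, while points of [A n] are at least
   twice that far away. *)
have [n Anl] := Acov l; have [_ _ /(_ l Anl)] := vP n.
by have := lv n.+1; have := v0 n.+1; lra.
Qed.

Context d (T : measurableType d) (mu : {finite_measure set T -> \bar R}).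
Variables (p : \bar R) (q : R) (p1 : (1 < p)%E) (pq : hoelder_conjugate p = q%:E).
Variable P : (T -> Cplx R) -> X.
Hypothesis P_lin : forall (c : Cplx R) h k, in_cLp mu p h -> in_cLp mu p k ->
  P (fun x => c * h x + k x) = c *: P h + P k.
Hypothesis P_bounded : bounded_on_Lp mu p P.
Hypothesis P_onto : onto_from_Lp mu p P.

Let p1' : (1 <= p)%E := ltW p1.

Lemma Lp_linear0 : P (fun=> 0) = 0.
Proof.
have := P_lin (-1) (in_cLp0 mu p1') (in_cLp0 mu p1').
rewrite scaleN1r addNr => <-; congr P; apply/funext => x.
by rewrite mulr0 addr0.
Qed.

Lemma Lp_linearZ (c : Cplx R) h : in_cLp mu p h -> P (fun x => c * h x) = c *: P h.
Proof.
move=> hp; have := P_lin c hp (in_cLp0 mu p1'); rewrite Lp_linear0 addr0 => <-.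
by congr P; apply/funext => x; rewrite addr0.
Qed.

Let PB h k : in_cLp mu p h -> in_cLp mu p k -> P (fun x => h x - k x) = P h - P k.
Proof.
move=> hp kp; rewrite -scaleN1r addrC -P_lin//.
by congr P; apply/funext => x; rewrite mulN1r addrC.
Qed.

Let in_cLpB h k : in_cLp mu p h -> in_cLp mu p k -> in_cLp mu p (fun x => h x - k x).
Proof.
move=> hp kp; have := in_cLpD p1' hp (in_cLpZ (-1) p1' kp).
by congr (in_cLp _ _ _); apply/funext => x; rewrite mulN1r.
Qed.

(* Baire's theorem makes the closure of the image of some ball a neighbourhood of 0. *)
Let approx : exists C : R, 0 <= C /\ forall x, exists h, [/\ in_cLp mu p h,
  (cLnorm mu p h <= (C * rnorm x)%:E)%E & rnorm (x - P h) <= rnorm x / 2].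
Proof.
pose A n : set X := [set x | exists h, [/\ in_cLp mu p h, P h = x &
  (cLnorm mu p h <= n%:R%:E)%E]].
have [n [x0 [r [r0 H]]]] : exists (n : nat) (x : X) (r : R), 0 < r /\
    forall y, rnorm (y - x) < r -> forall e : R, 0 < e ->
    exists2 a, A n a & rnorm (a - y) < e.
  apply: baire_cover => x; have [h hp <-] := P_onto x.
  have := cLnorm_ge0 mu p h; case: (hp) => _; case E : cLnorm => [c| |]// _.
  rewrite lee_fin => c0; exists (Num.bound c), h; split => //.
  by rewrite E lee_fin ltW// archi_boundP.
(* Subtracting approximations of y + x0 and of x0 recentres the ball at 0, at the price of a factor
   2 in the norm. *)
have small y (e : R) : rnorm y < r -> 0 < e -> exists h, [/\ in_cLp mu p h,
    (cLnorm mu p h <= (2 * n%:R)%:E)%E & rnorm (y - P h) < e].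
  move=> yr e0; have e2 : 0 < e / 2 by lra.
  have [_ [h1 [hp1 <- c1]] h1e] := H (y + x0) ltac:(by rewrite addrK) _ e2.
  have [_ [h2 [hp2 <- c2]] h2e] := H x0 ltac:(by rewrite subrr rnorm0) _ e2.
  exists (fun x => h1 x - h2 x); split; first exact: in_cLpB.
    have hp2' := in_cLpZ (-1) p1' hp2.
    have := cLnormD mu p1' hp1.1 hp2'.1; rewrite cLnormZ// rnormN rnorm1 mul1e.
    have -> : (fun x => h1 x + -1 * h2 x) = (fun x => h1 x - h2 x).
      by apply/funext => x; rewrite mulN1r.
    by move=> h; rewrite (le_trans h)// mulr_natl mulr2n EFinD leeD.
  rewrite PB//; have -> : y - (P h1 - P h2) = (P h2 - x0) - (P h1 - (y + x0)).
    by rewrite !opprB (addrC y x0) -(addrA x0) [RHS]addrA subrK addrCA.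
  by rewrite (le_lt_trans (ler_rnormB _ _))//; lra.
(* [x] is scaled by s = r / (2 |x|) to norm r / 2 and approximated within r / 4; dividing by s turns
   the bound 2 n into 4 n |x| / r and the error into |x| / 2. *)
pose C : R := 4 * n%:R / r.
have C0 : 0 <= C by rewrite divr_ge0 ?mulr_ge0// ltW.
exists C; split => // x; have [->|xn0] := eqVneq x 0.
  exists (fun=> 0); split; first exact: in_cLp0.
    rewrite rnorm0 mulr0 (_ : cLnorm mu p _ = 0%E)//.
    have := cLnormZ 0 p1' (in_cLp0 mu p1'); rewrite rnorm0 mul0e => <-.
    by congr cLnorm; apply/funext => y; rewrite mul0r.
  by rewrite Lp_linear0 subrr rnorm0 mul0r.
have x0' : 0 < rnorm x.
  by rewrite lt_neqAle rnorm_ge0 andbT eq_sym; apply: contra xn0 => /eqP/rnorm_eq0/eqP.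
pose s : R := r / 2 / rnorm x; have s0 : 0 < s by rewrite !divr_gt0.
have sx : rnorm (s%:C *: x) = r / 2.
  by rewrite rnormZ rnorm_real gtr0_norm// divfK// gt_eqF.
have sxr : rnorm (s%:C *: x) < r by rewrite sx; lra.
have [|h [hp hn hx]] := small _ (r / 4) sxr; first lra.
have sC0 : s%:C != 0 :> R[i] by apply/eqP => -[]; lra.
have nV : rnorm ((s%:C)^-1 : Cplx R) = s^-1 by rewrite rnormV rnorm_real gtr0_norm.
exists (fun x => (s%:C)^-1 * h x); split; first exact: in_cLpZ.
- rewrite cLnormZ// nV (le_trans (lee_wpmul2l _ hn)) ?lee_fin ?invr_ge0 ?(ltW s0)//.
  rewrite /s /C !invfM !invrK.
  by rewrite le_eqVlt; apply/orP; left; apply/eqP; field; rewrite gt_eqF.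
- rewrite Lp_linearZ//; have -> : x - (s%:C)^-1 *: P h = (s%:C)^-1 *: (s%:C *: x - P h).
    by rewrite scalerBr scalerA mulVf// scale1r.
  rewrite rnormZ nV (le_trans (ler_wpM2l _ (ltW hx))) ?invr_ge0 ?(ltW s0)//.
  rewrite /s !invfM !invrK.
  by rewrite le_eqVlt; apply/orP; left; apply/eqP; field; rewrite gt_eqF.
Qed.

(** Solving approximately for the residual of the previous step halves the error each time, so the
    approximate solutions decrease geometrically and [cLp_series] sums them to an exact one. *)
Lemma open_mapping : exists M : R, 0 < M /\ forall x, exists h,
  [/\ in_cLp mu p h, P h = x & (cLnorm mu p h <= (M * rnorm x)%:E)%E].
Proof.
have [C [C0 /choice[H HP]]] := approx.
have [B PB'] : exists B : R, 0 <= B /\ forall h, in_cLp mu p h ->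
    ((rnorm (P h))%:E <= B%:E * cLnorm mu p h)%E.
  have [B HB] := P_bounded; exists `|B|; split => // h hp.
  by rewrite (le_trans (HB h hp))// lee_wpmul2r ?cLnorm_ge0// lee_fin ler_norm.
(* The norms of the approximate solutions add up to at most 2 C |x|; the 1 makes the constant
   positive when [C] is 0. *)
exists (2 * C + 1); split=> [|x]; first by lra.
pose v := fix v n : X := if n is m.+1 then v m - P (H (v m)) else x.
have vhalf n : rnorm (v n) <= rnorm x / 2 ^+ n.
  elim: n => [|n ih] /=; first by rewrite expr0 divr1.
  have [_ _ h] := HP (v n); rewrite (le_trans h)// exprSr invfM mulrA ler_wpM2r//.
pose h_ n := H (v n).
have hp n : in_cLp mu p (h_ n) by have [] := HP (v n).
have hC n : (cLnorm mu p (h_ n) <= (C * rnorm x / 2 ^+ n)%:E)%E.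
  have [_ h _] := HP (v n); rewrite (le_trans h)// lee_fin -mulrA.
  by rewrite ler_wpM2l.
have [h [hLp hN]] := cLp_series p1 pq (fun n => (hp n).1) hC.
have sumP N : in_cLp mu p (fun y => \sum_(0 <= n < N) h_ n y) /\
    P (fun y => \sum_(0 <= n < N) h_ n y) = x - v N.
  elim: N => [|N [ih1 ih2]].
    rewrite (_ : (fun y => _) = fun=> 0); last by apply/funext => y; rewrite big_geq.
    by split; [exact: in_cLp0|rewrite Lp_linear0 subrr].
  rewrite (_ : (fun y => _) = fun y => 1 * h_ N y + \sum_(0 <= n < N) h_ n y); last first.
    by apply/funext => y; rewrite big_nat_recr//= mul1r addrC.
  split; first by apply: in_cLpD => //; exact: in_cLpZ.
  by rewrite P_lin// scale1r ih2 /= opprB addrCA addrA.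
exists h; split => //.
- apply/eqP; rewrite -subr_eq0; apply/eqP/rnorm_eq0/eqP.
  rewrite eq_le rnorm_ge0 andbT; apply/ler_addgt0Pr => e e0; rewrite add0r.
  (* K / 2^N bounds |P h - x|: [B] times the norm of the tail of the series, plus the residual
     [v N]. *)
  pose K := B * (2 * (C * rnorm x)) + rnorm x.
  have K0 : 0 <= K by rewrite addr_ge0 ?rnorm_ge0// !mulr_ge0 ?rnorm_ge0//; case: PB'.
  have : (fun N => K * (2^-1) ^+ N) @ \oo --> (0 : R).
    by apply: cvg_geometric; rewrite ger0_norm; lra.
  move=> /cvgrPdist_lt/(_ e e0)[N _ /(_ N (leqnn N))] /=.
  rewrite sub0r normrN => /ltW h1; have [sLp sP] := sumP N.
  have -> : P h - x = (P h - (x - v N)) - v N by rewrite opprB addrA addrAC addrK.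
  rewrite (le_trans (ler_rnormB _ _))// (le_trans _ (le_trans (ler_norm _) h1))//.
  rewrite -sP -PB// /K exprVn mulrDl lerD//.
  rewrite -lee_fin (le_trans (PB'.2 _ _))//; first exact: in_cLpB.
  rewrite -mulrA EFinM lee_wpmul2l ?lee_fin//; first by case: PB'.
- have := hN 0%N; rewrite expr0 divr1.
  rewrite (_ : (fun y => _) = h); last by apply/funext => y; rewrite big_geq// subr0.
  by move=> /le_trans; apply; rewrite lee_fin [leRHS]mulrDl mul1r -mulrA lerDl rnorm_ge0.
Qed.

End open_mapping.

(** * The boundedness criterion *)

Section main.
Context (R : realType) (X : completeNormedModType R[i]) (ev : X -> Cplx R -> Cplx R).
Hypothesis hX : analytic_function_space ev.
Context (d : measure_display) (Omega : measurableType d)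
  (mu : {finite_measure set Omega -> \bar R}).
Variable K : Cplx R -> Omega -> Cplx R.
Hypothesis K_analytic : forall w : Omega, analytic_on_disc (fun z => K z w).
Hypothesis K_measurable : forall z : Cplx R, unit_disc z -> cmeasurable (K z).
Hypothesis K_bounded : forall E : set (Cplx R), compact E -> E `<=` @unit_disc R ->
  exists B : R, forall (z : Cplx R) (w : Omega), E z -> rnorm (K z w) <= B.
Variables (p : \bar R) (q : R).
Hypotheses (p1 : (1 < p)%E) (pq : hoelder_conjugate p = q%:E).
Variable P : (Omega -> Cplx R) -> X.
Hypothesis P_kernel : represents_kernel mu p K ev P.
Hypothesis P_bounded : bounded_on_Lp mu p P.
Hypothesis P_onto : onto_from_Lp mu p P.
Local Open Scope complex_scope.

Let q1 : 1 <= q. Proof. exact: conjugate_ge1 p1 pq. Qed.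
Let q0 : 0 < q. Proof. exact: lt_le_trans ltr01 q1. Qed.
Let p1' : (1 <= p)%E := ltW p1.

Lemma Lp_integrable h : in_cLp mu p h ->
  mu.-integrable setT (fun w => (rnorm (h w))%:E).
Proof.
move=> [mh hp]; have [C [C0 HC]] := integral_le_Lnorm mu p1 pq.
apply/integrableP; split; first exact/measurable_EFinP/measurable_rnorm.
have := HC _ (measurable_rnorm mh) hp.
move=> /le_lt_trans; apply; rewrite lte_mul_pinfty// ?lee_fin//.
Qed.

Lemma Lp_kernel_cintegrable h z : in_cLp mu p h -> unit_disc z ->
  cintegrable mu setT (fun w => h w * K z w).
Proof.
move=> hp zD; have [B [B0 HB]] := kernel_segment_bounded K_bounded zD.
apply: (@cintegrable_le _ _ _ _ _ (fun w => B * rnorm (h w))).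
- by apply: cmeasurableM; [case: hp|exact: K_measurable].
- exact: (integrableZl measurableT B (Lp_integrable hp)).
- move=> w; rewrite rnormM mulrC ler_wpM2r ?rnorm_ge0//.
  by have := HB 1 w; rewrite mul1r; apply; rewrite lexx ler01.
Qed.

(** The kernel formula is linear in h at each point of the disc, and [ev] separates the elements of
    X by their values there. *)
Lemma P_linear (c : Cplx R) h k : in_cLp mu p h -> in_cLp mu p k ->
  P (fun w => c * h w + k w) = c *: P h + P k.
Proof.
move=> hp kp; case: hX => _ ev_lin ev_inj; apply: ev_inj => z zD.
rewrite ev_lin// !P_kernel//; last by apply: in_cLpD => //; exact: in_cLpZ.
have ih := Lp_kernel_cintegrable hp zD; have ik := Lp_kernel_cintegrable kp zD.
rewrite -(cintegralZ measurableT c ih) -cintegralD//; last exact: cintegrableZ.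
by apply: eq_cintegral => w _; ring.
Qed.

(** * Estimates for a fixed symbol g *)

Section symbol.
Variable g : Cplx R -> Cplx R.
Hypothesis g_analytic : analytic_on_disc g.
Local Notation kz z := (transform K g z).

Lemma T_opE h z : in_cLp mu p h -> unit_disc z ->
  T_op g (ev (P h)) z = cintegral mu setT (fun w => h w * kz z w).
Proof.
move=> hp zD.
have [_ _ H] := transformP mu K_analytic K_measurable K_bounded g_analytic zD.
apply: H; [by case: hp|exact: Lp_integrable|].
by move=> u uD; rewrite P_kernel.
Qed.

Lemma Lp_transform_cintegrable h z : in_cLp mu p h -> unit_disc z ->
  cintegrable mu setT (fun w => h w * kz z w).
Proof.
move=> hp zD.
have [mk [B HB] _] := transformP mu K_analytic K_measurable K_bounded g_analytic zD.
apply: (@cintegrable_le _ _ _ _ _ (fun w => B * rnorm (h w))).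
- by apply: cmeasurableM => //; case: hp.
- exact: (integrableZl measurableT B (Lp_integrable hp)).
- by move=> w; rewrite rnormM mulrC ler_wpM2r ?rnorm_ge0.
Qed.

(** Writing [x] as an image under [P] reduces homogeneity to that of an integral over Omega whose
    integrand is known to be integrable. *)
Lemma T_opZ (c : Cplx R) x z : unit_disc z ->
  T_op g (ev (c *: x)) z = c * T_op g (ev x) z.
Proof.
move=> zD; have [h hp <-] := P_onto x.
have hc : in_cLp mu p (fun w => c * h w) := in_cLpZ c p1' hp.
have -> : c *: P h = P (fun w => c * h w).
  by rewrite (Lp_linearZ p1 P_linear).
rewrite !T_opE// -(cintegralZ measurableT c (Lp_transform_cintegrable hp zD)).
by apply: eq_cintegral => w _; rewrite mulrA.
Qed.

Local Open Scope ereal_scope.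

Lemma unit_disc0 : unit_disc (0%R : Cplx R).
Proof. by apply/unit_discE; rewrite rnorm0. Qed.

Lemma Hinfty_norm_ge0 (f : Cplx R -> Cplx R) : 0 <= Hinfty_norm f.
Proof.
apply: (@le_trans _ _ (rnorm (f 0%R))%:E); first by rewrite lee_fin rnorm_ge0.
by apply: ereal_sup_ubound; exists 0%R => //; exact: unit_disc0.
Qed.

Lemma rnorm_le_Hinfty (f : Cplx R -> Cplx R) z : unit_disc z ->
  (rnorm (f z))%:E <= Hinfty_norm f.
Proof. by move=> zD; apply: ereal_sup_ubound; exists z. Qed.

Lemma T_norm_ge0 : 0 <= T_norm g ev.
Proof.
apply: (le_trans (Hinfty_norm_ge0 (T_op g (ev 0%R)))).
by apply: ereal_sup_ubound; exists 0%R => //=; rewrite normr0.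
Qed.

Lemma T_norm_bound x z : unit_disc z ->
  (rnorm (T_op g (ev x) z))%:E <= T_norm g ev * (rnorm x)%:E.
Proof.
move=> zD; have [->|xn0] := eqVneq x 0%R.
  (* [T_norm] may be +oo, and +oo times 0 is 0, so T_g must be seen to vanish at 0. *)
  have := T_opZ 0%R 0%R zD; rewrite scale0r mul0r => ->.
  by rewrite !rnorm0 mule0.
have x0 : (0 < rnorm x)%R.
  by rewrite lt_neqAle rnorm_ge0 andbT eq_sym; apply: contra xn0 => /eqP/rnorm_eq0/eqP.
pose u := ((rnorm x)^-1)%:C *: x.
have xu : x = (rnorm x)%:C *: u.
  by rewrite /u scalerA -rmorphM/= divff ?gt_eqF// scale1r.
have u1 : (`|u| <= 1)%R.
  by rewrite norm_rnorm /u rnormZ rnorm_real gtr0_norm ?invr_gt0// mulVf ?gt_eqF.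
rewrite {1}xu T_opZ// rnormM rnorm_real gtr0_norm// mulrC EFinM lee_wpmul2r ?lee_fin ?(ltW x0)//.
apply: (le_trans (rnorm_le_Hinfty _ zD)).
by apply: ereal_sup_ubound; exists u.
Qed.

Lemma P_norm_ge0 : 0 <= P_norm mu p P.
Proof.
have h0 := in_cLp0 mu p1'.
apply: (@le_trans _ _ (rnorm (P (fun=> 0%R)))%:E); first by rewrite lee_fin rnorm_ge0.
apply: ereal_sup_ubound; exists (fun=> 0%R) => //; split => //.
have := cLnormZ 0%R p1' h0; rewrite rnorm0 mul0e => h.
rewrite (_ : cLnorm _ _ _ = 0) ?lee01// -h.
by congr cLnorm; apply/funext => w; rewrite mulr0.
Qed.

Local Notation Iz z := (\int[mu]_w (rnorm (kz z w) `^ q)%:E).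

(* The extremal function of Hoelder's inequality for [kz z]. For [kz z w = 0] the
   junk value of the negative power is multiplied by [0]. *)
Let dual z (c : R) w : Cplx R :=
  (conjc (kz z w) * (rnorm (kz z w) `^ (q - 2) * c)%:C)%R.

Let conj_mul (u : Cplx R) : (u * conjc u)%R = ((rnorm u ^+ 2)%R)%:C.
Proof.
have e : `|u : R[i]|%R = (rnorm u)%:C := norm_rnorm u.
by rewrite -[LHS](sqr_normc u) e rmorphXn.
Qed.

Let rnorm_conj (u : Cplx R) : rnorm (conjc u : Cplx R) = rnorm u.
Proof. by rewrite /rnorm normcJ. Qed.

Let dual_mul z c w : (dual z c w * kz z w)%R = ((c * rnorm (kz z w) `^ q)%R)%:C.
Proof.
rewrite /dual mulrAC [(conjc _ * _)%R]mulrC conj_mul -rmorphM/=; congr (_%:C).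
(* Exponents add only for a nonzero base; at 0 both sides vanish because q > 0. *)
have [->|k0] := eqVneq (rnorm (kz z w)) 0%R.
  by rewrite expr0n mul0r powR0 ?mulr0// gt_eqF.
rewrite mulrA -powR_mulrn ?rnorm_ge0// -powRD ?k0 ?implybT//.
by rewrite addrC subrK mulrC.
Qed.

Let rnorm_dual z (c : R) w : (0 <= c)%R ->
  rnorm (dual z c w) = if kz z w == 0%R then 0%R else (rnorm (kz z w) `^ (q - 1) * c)%R.
Proof.
move=> c0; rewrite /dual rnormM rnorm_conj rnorm_real ger0_norm ?mulr_ge0 ?powR_ge0//.
case: ifPn => [/eqP ->|k0]; first by rewrite rnorm0 mul0r.
have r0 : rnorm (kz z w) != 0%R by apply: contra k0 => /eqP/rnorm_eq0/eqP.
rewrite mulrA -[X in (X * _ * _)%R]powRr1 ?rnorm_ge0// -powRD ?r0 ?implybT//.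
by congr ((_ `^ _) * _)%R; ring.
Qed.

Lemma kernel_integral_le z : unit_disc z ->
  Iz z <= P_norm mu p P `^ q * T_norm g ev `^ q.
Proof.
move=> zD.
have [mk [B HB] _] := transformP mu K_analytic K_measurable K_bounded g_analytic zD.
have mI : measurable_fun setT (fun w => rnorm (kz z w) `^ q)%R.
  exact: (measurableT_comp (@measurable_powR R q) (measurable_rnorm mk)).
have I_ge0 : 0 <= Iz z by apply: integral_ge0 => w _; rewrite lee_fin powR_ge0.
(* Finiteness comes from the boundedness of k_z on a finite measure space, not from T_g; the
   normalisation below needs a finite positive [i]. *)
have iI : mu.-integrable setT (fun w => (rnorm (kz z w) `^ q)%:E).
  apply: (@le_integrable _ _ _ mu _ measurableT _ (fun=> (B `^ q)%:E)).
  - exact/measurable_EFinP.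
  - move=> w _; rewrite lee_fin !ger0_norm ?powR_ge0// ge0_ler_powR ?(ltW q0)// nnegrE ?rnorm_ge0//.
    by rewrite (le_trans (rnorm_ge0 _) (HB w)).
  - exact: finite_measure_integrable_cst.
have If : Iz z \is a fin_num by exact: integrable_fin_num.
pose i := fine (Iz z); have iE : Iz z = i%:E by rewrite fineK.
rewrite iE; have i0 : (0 <= i)%R by exact: fine_ge0.
move: i0; rewrite le_eqVlt => /predU1P[<-|i0].
  by rewrite mule_ge0 ?poweR_ge0.
(* This power brings the L^p norm of [dual z c] down to at most 1, while its pairing with k_z is c i
   = i^(1/q). *)
pose c : R := (i `^ (q^-1 - 1))%R; have c0 : (0 < c)%R by rewrite powR_gt0.
have mh : cmeasurable (dual z c).
  apply: cmeasurableM; first exact: cmeasurable_conj.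
  apply: cmeasurable_real; apply: measurable_funM; last exact: measurable_cst.
  exact: (measurableT_comp (@measurable_powR R (q - 2)) (measurable_rnorm mk)).
have h1 : cLnorm mu p (dual z c) <= 1.
  have [[-> qE]|[r [-> r1 _ rq]]] := conjugate_cases p1 pq.
    (* Here q = 1 and c = 1: the test function is the conjugate phase of k_z, of modulus 1 or 0. *)
    apply/(Lnormy_le mu (fun w => rnorm (dual z c w)) ler01); apply: nearW => w.
    rewrite ger0_norm ?rnorm_ge0// rnorm_dual ?(ltW c0)//.
    by case: ifPn => // _; rewrite /c qE invr1 subrr !powRr0 mulr1.
  have r0 : (0 < r)%R := lt_trans ltr01 r1.
  have rn0 : r != 0%R by rewrite gt_eqF.
  have qn0 : q != 0%R by rewrite gt_eqF.
  (* By this relation the r-th power of |dual| is |k_z|^q / i, whose integral is 1. *)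
  have qr : ((q - 1) * r = q)%R.
    have : (q * r * (r^-1 + q^-1) = q * r)%R by rewrite rq mulr1.
    have -> : (q * r * (r^-1 + q^-1) = q + r)%R by field; apply/andP.
    by move=> h; rewrite mulrBl -h mul1r addrK.
  have cr : (c `^ r = i^-1)%R.
    rewrite /c -powRrM (_ : (q^-1 - 1) * r = -1)%R ?powR_inv1 ?(ltW i0)//.
    have -> : (q^-1 - 1 = - r^-1)%R by rewrite -rq opprD addrCA subrr addr0.
    by rewrite mulNr mulVf.
  have -> : cLnorm mu r%:E (dual z c) =
      (\int[mu]_w (`|rnorm (dual z c w)| `^ r)%:E) `^ r^-1 by exact: LnormrE.
  under eq_integral => w _.
    rewrite (_ : (`|rnorm (dual z c w)| `^ r = i^-1 * rnorm (kz z w) `^ q)%R); last first.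
      rewrite ger0_norm ?rnorm_ge0// rnorm_dual ?(ltW c0)//; case: ifPn => [/eqP ->|_].
        by rewrite rnorm0 !powR0// mulr0.
      by rewrite powRM ?powR_ge0 ?(ltW c0)// -powRrM qr cr mulrC.
    rewrite EFinM; over.
  rewrite integralZl// iE -EFinM mulVf ?gt_eqF//.
  by rewrite poweR1r.
have hp : in_cLp mu p (dual z c) by split; rewrite ?(le_lt_trans h1) ?ltry.
have Th : T_op g (ev (P (dual z c))) z = ((i `^ q^-1)%R)%:C.
  rewrite T_opE//; under eq_cintegral => w _ do rewrite dual_mul.
  rewrite /cintegral/= Rintegral_cst// mul0r; congr (_%:C).
  rewrite (RintegralZl c measurableT iI) -[X in (_ * X)%R]/i.
  rewrite -[X in (_ * X)%R](@powRr1 R i) ?(ltW i0)// /c -powRD ?subrK//.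
  by rewrite (gt_eqF i0) implybT.
have := T_norm_bound (P (dual z c)) zD; rewrite Th rnorm_real ger0_norm ?powR_ge0//.
have xP : (rnorm (P (dual z c)))%:E <= P_norm mu p P.
  by apply: ereal_sup_ubound; exists (dual z c).
move=> /le_trans/(_ (lee_wpmul2l T_norm_ge0 xP)) le1.
have -> : i%:E = (i `^ q^-1)%:E `^ q.
  by rewrite poweR_EFin -powRrM mulVf ?gt_eqF// powRr1// ltW.
rewrite -poweRM ?P_norm_ge0 ?T_norm_ge0// [X in _ <= X `^ _]muleC.
rewrite gt0_ler_poweR ?(ltW q0)// in_itv/= ?leey ?andbT ?lee_fin ?powR_ge0//.
by rewrite mule_ge0 ?T_norm_ge0 ?P_norm_ge0.
Qed.

Lemma kernel_sup_le :
  kernel_sup mu g K q <= P_norm mu p P `^ q * T_norm g ev `^ q.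
Proof. by apply: ge_ereal_sup => _ [z zD <-]; exact: kernel_integral_le. Qed.

Lemma kernel_sup_ge0 : 0 <= kernel_sup mu g K q.
Proof.
apply: (@le_trans _ _ (Iz 0%R)).
  by apply: integral_ge0 => w _; rewrite lee_fin powR_ge0.
by apply: ereal_sup_ubound; exists 0%R => //; exact: unit_disc0.
Qed.

(** Hoelder's inequality for the integral against k_z. The factor 2 is that of [cintegral_le] and
    only enlarges the final constant. *)
Lemma T_op_le h z : in_cLp mu p h -> unit_disc z ->
  (rnorm (T_op g (ev (P h)) z))%:E <=
    2%:E * (cLnorm mu p h * kernel_sup mu g K q `^ q^-1).
Proof.
move=> hp zD; have [mh hoo] := hp.
have [mk [B HB] _] := transformP mu K_analytic K_measurable K_bounded g_analytic zD.
have [mrh mrk] := (measurable_rnorm mh, measurable_rnorm mk).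
have ihk : mu.-integrable setT
    (EFin \o (fun w => rnorm (h w) * rnorm (kz z w))%R).
  apply: (@le_integrable _ _ _ mu _ measurableT _ (fun w => (B * rnorm (h w))%:E)).
  - by apply/measurable_EFinP; exact: measurable_funM.
  - move=> w _; rewrite lee_fin ger0_norm ?mulr_ge0 ?rnorm_ge0//.
    rewrite (le_trans _ (ler_norm _))// mulrC ler_wpM2r ?rnorm_ge0//.
  - exact: (integrableZl measurableT B (Lp_integrable hp)).
rewrite T_opE//.
have le1 := cintegral_le measurableT (Lp_transform_cintegrable hp zD) ihk.
have {}le1 := le1 ltac:(by move=> w _; rewrite rnormM).
apply: (@le_trans _ _ (2%:E * \int[mu]_w (rnorm (h w) * rnorm (kz z w))%:E)).
  have fE := integrable_fin_num measurableT ihk.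
  by rewrite -[X in _ <= _ * X](fineK fE) -EFinM lee_fin.
rewrite lee_wpmul2l ?lee_fin//.
have := hoelder_conjugates p1 pq mrh mrk hoo.
under eq_integral do rewrite ger0_norm ?mulr_ge0 ?rnorm_ge0//.
move=> le2; rewrite (le_trans le2)// lee_wpmul2l ?cLnorm_ge0//.
rewrite LnormrE; under eq_integral do rewrite ger0_norm ?rnorm_ge0//.
have I_ge0 : 0 <= Iz z by apply: integral_ge0 => w _; rewrite lee_fin powR_ge0.
rewrite gt0_ler_poweR ?invr_ge0 ?(ltW q0)// ?in_itv/= ?leey ?andbT ?kernel_sup_ge0//.
by apply: ereal_sup_ubound; exists z.
Qed.

Lemma T_op_Hinfty x (B : R) :
  (forall z, unit_disc z -> rnorm (T_op g (ev x) z) <= B)%R ->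
  in_Hinfty (T_op g (ev x)).
Proof.
move=> TB; split; last by exists B.
apply: analytic_segment_integral => z zD; apply: analytic_mul.
  by case: hX => ev_analytic _ _; exact: ev_analytic.
exact/analytic_derive1/g_analytic.
Qed.

End symbol.

Local Open Scope ereal_scope.

Lemma T_norm_lt_pinfty g : T_bounded g ev -> T_norm g ev < +oo.
Proof.
move=> [_ [B HB]]; apply: (@le_lt_trans _ _ `|B|%:E); last exact: ltry.
apply: ge_ereal_sup => _ [x /= x1 <-]; rewrite (le_trans (HB x))// lee_fin.
have {}x1 : (rnorm x <= 1)%R by move: x1; rewrite norm_rnorm (_ : 1 = 1%:C)%R// lecR.
rewrite (le_trans (ler_norm _))// normrM (ger0_norm (rnorm_ge0 x)).
by rewrite ler_piMr.
Qed.

Lemma P_norm_lt_pinfty : P_norm mu p P < +oo.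
Proof.
have [B HB] := P_bounded; apply: (@le_lt_trans _ _ `|B|%:E); last exact: ltry.
apply: ge_ereal_sup => _ [h [hp h1] <-]; rewrite (le_trans (HB h hp))//.
apply: (@le_trans _ _ (`|B|%:E * cLnorm mu p h)).
  by rewrite lee_wpmul2r ?cLnorm_ge0// lee_fin ler_norm.
by rewrite -[leRHS]mule1 lee_wpmul2l.
Qed.

Theorem boundedness_criterion :
  (forall g, analytic_on_disc g -> T_bounded g ev <-> kernel_sup mu g K q < +oo) /\
  (exists M : R, (0 < M)%R /\ forall g, analytic_on_disc g ->
     (M `^ (- q))%:E * T_norm g ev `^ q <= kernel_sup mu g K q /\
     kernel_sup mu g K q <= P_norm mu p P `^ q * T_norm g ev `^ q).
Proof.
(* The constant is extracted from [P] before any g is fixed, so it serves all symbols at once. *)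
have [M [M0 HM]] := open_mapping p1 pq P_linear P_bounded P_onto.
have T_le g : analytic_on_disc g -> forall x z, unit_disc z ->
    (rnorm (T_op g (ev x) z))%:E <=
    (2 * M * rnorm x)%:E * kernel_sup mu g K q `^ q^-1.
  move=> ga x z zD; have [h [hp <- hM]] := HM x.
  rewrite (le_trans (T_op_le ga hp zD))// -mulrA EFinM -muleA.
  by rewrite lee_wpmul2l ?lee_fin// lee_wpmul2r ?poweR_ge0.
have M20 : (0 < 2 * M)%R by rewrite mulr_gt0.
split.
- move=> g ga; split=> [Tb|Sfin].
    apply: (le_lt_trans (kernel_sup_le ga)).
    by rewrite lte_mul_pinfty ?poweR_ge0 ?fin_num_poweR ?poweR_lty ?T_norm_lt_pinfty//
      ge0_fin_numE ?P_norm_ge0 ?P_norm_lt_pinfty.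
  have Sf : kernel_sup mu g K q `^ q^-1 \is a fin_num.
    by rewrite fin_num_poweR// ge0_fin_numE ?kernel_sup_ge0.
  set s := fine (kernel_sup mu g K q `^ q^-1).
  have TB x z : unit_disc z -> (rnorm (T_op g (ev x) z) <= 2 * M * s * rnorm x)%R.
    by move=> zD; have := T_le g ga x z zD; rewrite -(fineK Sf) -EFinM lee_fin mulrAC.
  split=> [x|]; first by apply: (T_op_Hinfty ga (TB x)).
  exists (2 * M * s)%R => x; apply: ge_ereal_sup => _ [z zD <-].
  by rewrite lee_fin TB.
(* [M] is the cost of lifting [x] to L^p and 2 the factor in [T_op_le]. *)
- exists (2 * M)%R; split => // g ga; split; last exact: kernel_sup_le.
  have S0 := kernel_sup_ge0 g.
  have TS : T_norm g ev <= (2 * M)%:E * kernel_sup mu g K q `^ q^-1.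
    apply: ge_ereal_sup => _ [x /= x1 <-]; apply: ge_ereal_sup => _ [z zD <-].
    have {}x1 : (rnorm x <= 1)%R by move: x1; rewrite norm_rnorm (_ : 1 = 1%:C)%R// lecR.
    rewrite (le_trans (T_le g ga x z zD))// lee_wpmul2r ?poweR_ge0// lee_fin.
    by rewrite ler_piMr// ltW.
  have TSq : T_norm g ev `^ q <= ((2 * M) `^ q)%:E * kernel_sup mu g K q.
    have -> : ((2 * M) `^ q)%:E * kernel_sup mu g K q =
        ((2 * M)%:E * kernel_sup mu g K q `^ q^-1) `^ q.
      rewrite poweRM ?poweR_ge0 ?lee_fin ?(ltW M20)// -poweRrM mulVf ?gt_eqF//.
      by rewrite poweRe1.
    rewrite gt0_ler_poweR ?(ltW q0)// ?in_itv/= ?leey ?andbT ?T_norm_ge0//.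
    by rewrite mule_ge0 ?poweR_ge0// lee_fin ltW.
  apply: (@le_trans _ _ (((2 * M) `^ (- q))%:E * (((2 * M) `^ q)%:E * kernel_sup mu g K q))).
    by rewrite lee_wpmul2l// lee_fin powR_ge0.
  rewrite muleA -EFinM -powRD ?addNr ?powRr0 ?mul1e//.
  by rewrite (gt_eqF M20) implybT.
Qed.

End main.

Unset Implicit Arguments.

Theorem theorem2p4 (R : realType)
  (X : completeNormedModType R[i]) (ev : X -> Cplx R -> Cplx R)
  (hX : analytic_function_space ev)
  (d : measure_display) (Omega : measurableType d)
  (mu : {finite_measure set Omega -> \bar R})
  (K : Cplx R -> Omega -> Cplx R)
  (K_analytic : forall w : Omega, analytic_on_disc (fun z => K z w))
  (K_measurable : forall z : Cplx R, unit_disc z -> cmeasurable (K z))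
  (K_bounded : forall E : set (Cplx R), compact E -> E `<=` @unit_disc R ->
     exists B : R, forall (z : Cplx R) (w : Omega), E z -> rnorm (K z w) <= B)
  (p : \bar R) (hp : (1 < p)%E)
  (p' : R) (hp' : hoelder_conjugate p = p'%:E)
  (P : (Omega -> Cplx R) -> X)
  (P_kernel : represents_kernel mu p K ev P)
  (P_bounded : bounded_on_Lp mu p P)
  (P_onto : onto_from_Lp mu p P) :
  (forall g : Cplx R -> Cplx R, analytic_on_disc g ->
     (T_bounded g ev <-> (kernel_sup mu g K p' < +oo)%E)) /\
  (exists M : R, 0 < M /\
     forall g : Cplx R -> Cplx R, analytic_on_disc g ->
       ((M `^ (- p'))%:E * T_norm g ev `^ p' <= kernel_sup mu g K p')%E /\
       (kernel_sup mu g K p' <= P_norm mu p P `^ p' * T_norm g ev `^ p')%E).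
Proof.
exact: (boundedness_criterion hX K_analytic K_measurable K_bounded hp hp'
  P_kernel P_bounded P_onto).
Qed.
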